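(* Let $d\ge2$, let $A\subseteq\mathbb{R}^d$ be a nonempty compact set and $i\in\{0,\ldots,d-1\}$. Assume that for some $q\in\mathbb{R}$ the $q$-dimensional basic contents $\mathcal M_j^q(A)$ of order $j$ exist (in $\mathbb{R}$) for all $j\in\{0,\ldots,i\}$. Then the $q$-dimensional support content $\mathcal S_i^q(A)$ of order $i$ exists and is given by $$\mathcal S_i^q(A)=\sum_{j=0}^i c_{i,j}\,\mathcal M_j^q(A),\qquad c_{i,j}=\binom{d-j}{d-i}\frac{\kappa_{d-j}}{\kappa_{d-i}} .$$ Moreover, if $q\neq d$ and the basic contents $\mathcal M_j^q(A)$ exist (in $\mathbb{R}$) for all $j\in\{0,\ldots,d-1\}$, then the outer Minkowski content $\mathcal M^{\mathrm{out},q}(A)$ exists and is given by $$\mathcal M^{\mathrm{out},q}(A)=\frac1{d-q}\sum_{j=0}^{d-1}\omega_{d-j}\,\mathcal M_j^q(A).$$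
   Context: Notation: $V$ is Lebesgue measure on $\mathbb{R}^d$, $|\cdot|$ the Euclidean norm, $\mathbb{S}^{d-1}$ the unit sphere, $\kappa_k=\pi^{k/2}/\Gamma(k/2+1)$, $\omega_k=k\kappa_k$, $A_\varepsilon=\{x\in\mathbb{R}^d:\mathrm{dist}(x,A)\le\varepsilon\}$. For a nonempty closed set $A\subset\mathbb{R}^d$, $\mathrm{Unp}(A)$ is the set of $y\in\mathbb{R}^d\setminus A$ having a unique nearest point $\pi_A(y)$ in $A$. The generalized normal bundle is $N(A)=\{(\pi_A(y),\frac{y-\pi_A(y)}{\mathrm{dist}(y,A)}):y\in \mathrm{Unp}(A)\}$. The local reach of $A$ at $(x,u)\in N(A)$ is $\delta(A,x,u)=\sup\{t\ge 0:\pi_A(x+tu)=x\}\in(0,\infty]$. Support measures (Hug, Last, Weil): for every nonempty closed $A\subset\mathbb{R}^d$ there are signed measures $\mu_0(A;\cdot),\ldots,\mu_{d-1}(A;\cdot)$ concentrated on $N(A)$ (each a difference $\mu_i^+-\mu_i^-$ of mutually singular $\sigma$-finite Borel measures on $\mathbb{R}^d\times\mathbb{S}^{d-1}$ vanishing outside $N(A)$; $|\mu_i|=\mu_i^++\mu_i^-$ is the total variation measure) such that $\int_{N(A)}\mathbf 1\{x\in B\}\min\{r,\delta(A,x,u)\}^{d-i}\,|\mu_i|(A;d(x,u))<\infty$ for all compact $B\subset\mathbb{R}^d$, $r>0$, and, for every bounded measurable $f:\mathbb{R}^d\to\mathbb{R}$ with compact support, $$\int_{\mathbb{R}^d\setminus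 A}f(x)\,dx=\sum_{i=0}^{d-1}\omega_{d-i}\int_0^\infty\int_{N(A)}t^{d-i-1}\mathbf 1\{t<\delta(A,x,u)\}f(x+tu)\,\mu_i(A;d(x,u))\,dt.$$ These properties determine the measures; they are called the support measures of $A$. For $A$ compact and $\varepsilon>0$ the total mass $\mu_i(A_\varepsilon):=\mu_i(A_\varepsilon;\mathbb{R}^d\times\mathbb{S}^{d-1})$ is well defined and finite. For $A$ compact and $t>0$, the $i$-th basic function is $\beta_i(A;t)=\int_{N(A)}\mathbf 1\{t<\delta(A,x,u)\}\,\mu_i(A;d(x,u))$ (a real number). Contents: $\mathcal M_i^q(A):=\lim_{t\to0^+}t^{q-i}\beta_i(A;t)$ ($q$-dimensional $i$-th basic content), $\mathcal S_i^q(A):=\lim_{\varepsilon\to0^+}\varepsilon^{q-i}\mu_i(A_\varepsilon)$ ($q$-dimensional $i$-th support content), and $\mathcal M^{\mathrm{out},q}(A):=\lim_{\varepsilon\to0^+}\varepsilon^{q-d}V(A_\varepsilon\setminus A)$ ($q$-dimensional outer Minkowski content); each is said to exist if the respective limit exists. *)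

(* Defs.v *)
From HB Require Import structures.
From mathcomp Require Import all_boot all_order all_algebra.
From mathcomp Require Import all_classical all_reals all_analysis.
From mathcomp Require Import measurable_realfun.

Set Implicit Arguments.
Unset Strict Implicit.
Unset Printing Implicit Defensive.

Import Order.TTheory GRing.Theory Num.Theory.
Import numFieldNormedType.Exports.

Local Open Scope classical_set_scope.
Local Open Scope ring_scope.

(* R^n is 'rV[R]_n. Its library norm is the sup norm, which induces the usual
   topology; the Euclidean norm is [enorm] below. *)

Fact borel_mx_display : measure_display. Proof. exact. Qed.

Section borel_matrix.
Context (R : realType) (m n : nat).

Let borel0 : <<s @open 'M[R]_(m, n) >> set0.
Proof. exact: sigma_algebra0. Qed.

Let borelC (A : set 'M[R]_(m, n)) :
  <<s @open 'M[R]_(m, n) >> A -> <<s @open 'M[R]_(m, n) >> (~` A).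
Proof. exact: sigma_algebraC. Qed.

Let borel_bigcup (F : (set 'M[R]_(m, n))^nat) :
  (forall i, <<s @open 'M[R]_(m, n) >> (F i)) ->
  <<s @open 'M[R]_(m, n) >> (\bigcup_i (F i)).
Proof. exact: sigma_algebra_bigcup. Qed.

HB.instance Definition _ := @isMeasurable.Build borel_mx_display
  'M[R]_(m, n) <<s @open 'M[R]_(m, n) >> borel0 borelC borel_bigcup.

End borel_matrix.

Section borel_row.
Context (R : realType) (n : nat).

Lemma measurable_coord (j : 'I_n) :
  measurable_fun [set: 'rV[R]_n] (fun x : 'rV[R]_n => x ord0 j).
Proof.
apply: (@measurability _ _ _ _ _ _ (@RGenOpens.G R)).
  exact: RGenOpens.measurableE.
move=> _ [_ [a [b ->] <-]]; rewrite setTI.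
apply: sub_sigma_algebra; apply: open_comp; last exact: interval_open.
by move=> x _; exact: coord_continuous.
Qed.

Lemma open_rV_bigcup_box (U : set 'rV[R]_n) : open U ->
  let box (qr : 'rV[rat]_n * rat) : set 'rV[R]_n :=
    [set x | forall j, `|ratr (qr.1 ord0 j) - x ord0 j| < ratr qr.2] in
  U = \bigcup_(qr in [set qr | box qr `<=` U]) box qr.
Proof.
move=> oU box; apply/seteqP; split; last by move=> x [qr /= + ?]; exact.
move=> x Ux; have /nbhs_ballP[e /= e0 eU] : nbhs x U by exact: open_nbhs_nbhs.
have [r /itvP re] : exists r : rat, ratr r \in `]0%R, (e / 2)[.
  by apply: rat_in_itvoo; rewrite divr_gt0.
have r0 : 0 < (ratr r : R) by rewrite re.
have /choice[q qP] : forall j : 'I_n, exists q : rat,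
    ratr q \in `](x ord0 j - ratr r), (x ord0 j + ratr r)[.
  by move=> j; apply: rat_in_itvoo; rewrite ltrBlDr -addrA ltrDl addr_gt0.
have qx j : `|ratr (q j) - x ord0 j| < ratr r.
  by have /itvP qj := qP j; rewrite ltr_distl !qj.
exists (\row_j q j, r) => /=; last by move=> j; rewrite mxE.
move=> y /= yP; apply: eU; split => // i j; rewrite /ball /= ord1.
have := yP j; rewrite mxE => yj; rewrite [e]splitr.
rewrite (le_lt_trans (ler_distD (ratr (q j)) _ _))// distrC.
by rewrite ltrD// (lt_trans (qx j), lt_trans yj)// re.
Qed.

Lemma measurable_fun_rV d (T : measurableType d) (f : T -> 'rV[R]_n) :
  (forall j, measurable_fun setT (fun x => f x ord0 j)) ->
  measurable_fun setT f.
Proof.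
move=> mf; apply: (@measurability _ _ T _ setT f (@open 'rV[R]_n)) => //.
move=> _ [U oU <-]; rewrite setTI (open_rV_bigcup_box oU) preimage_bigcup.
rewrite bigcup_mkcond; apply: countable_bigcupT_measurable => [//|qr].
case: ifP => // _; rewrite (_ : _ @^-1` _ =
    \bigcap_(j in [set: 'I_n])
      ((fun x => `|ratr (qr.1 ord0 j) - f x ord0 j|) @^-1` `]-oo, ratr qr.2[)).
  apply: fin_bigcap_measurable => [|j _]; first exact: finite_finset.
  rewrite -[X in measurable X]setTI.
  have mg : measurable_fun setT (fun x => `|ratr (qr.1 ord0 j) - f x ord0 j|).
    apply: (@measurableT_comp _ _ _ _ _ _ (@Num.norm R R)) => //.
    exact: measurable_funB.
  exact: mg.
apply/seteqP; split => x /= h j; first by move=> _; rewrite /= in_itv/=; exact: h.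
by have := h j I; rewrite /= in_itv.
Qed.

End borel_row.

Section lebesgue_rV_step.
Context (R : realType) (n : nat).

Definition consrV (p : R * 'rV[R]_n) : 'rV[R]_n.+1 :=
  \row_j (if unlift ord0 j is Some k then p.2 ord0 k else p.1).

Definition unconsrV (x : 'rV[R]_n.+1) : R * 'rV[R]_n :=
  (x ord0 ord0, \row_j x ord0 (lift ord0 j)).

Lemma consrV0 p : consrV p ord0 ord0 = p.1.
Proof. by rewrite mxE unlift_none. Qed.

Lemma consrVS p j : consrV p ord0 (lift ord0 j) = p.2 ord0 j.
Proof. by rewrite mxE liftK. Qed.

Lemma consrVK : cancel consrV unconsrV.
Proof.
move=> p; rewrite /unconsrV consrV0 [RHS]surjective_pairing; congr pair.
by apply/rowP => j; rewrite mxE consrVS.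
Qed.

Lemma measurable_consrV : measurable_fun setT consrV.
Proof.
apply: measurable_fun_rV => j; case: (unliftP ord0 j) => [k|] ->.
  under eq_fun do rewrite consrVS.
  exact: (measurableT_comp (measurable_coord k) measurable_snd).
by under eq_fun do rewrite consrV0; exact: measurable_fst.
Qed.

Lemma measurable_unconsrV : measurable_fun setT unconsrV.
Proof.
apply: measurable_fun_pair; first exact: measurable_coord.
apply: measurable_fun_rV => j; under eq_fun do rewrite mxE.
exact: measurable_coord.
Qed.

Variable mu : {sigma_finite_measure set 'rV[R]_n -> \bar R}.

Definition lebesgue_cons : set 'rV[R]_n.+1 -> \bar R :=
  pushforward (@lebesgue_measure R \x mu)%E consrV.

Let lebesgue_cons0 : lebesgue_cons set0 = 0%E.
Proof. by rewrite /lebesgue_cons /pushforward preimage_set0 measure0. Qed.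

Let lebesgue_cons_ge0 A : (0 <= lebesgue_cons A)%E.
Proof. exact: (measure_ge0 (@lebesgue_measure R \x mu)%E). Qed.

Let lebesgue_cons_sigma_additive : semi_sigma_additive lebesgue_cons.
Proof.
have pre (A : set 'rV[R]_n.+1) : measurable A -> measurable (consrV @^-1` A).
  by move=> mA; rewrite -[X in measurable X]setTI; exact: measurable_consrV.
move=> F mF tF mUF; rewrite /lebesgue_cons /pushforward preimage_bigcup.
apply: measure_semi_sigma_additive => [k||]; first exact: pre.
- apply/trivIsetP => /= i j _ _ ij; rewrite -preimage_setI.
  by move/trivIsetP : tF => /(_ _ _ _ _ ij) ->//; rewrite preimage_set0.
- by rewrite -preimage_bigcup; exact: pre.
Qed.

HB.instance Definition _ := isMeasure.Build _ _ _ lebesgue_cons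
  lebesgue_cons0 lebesgue_cons_ge0 lebesgue_cons_sigma_additive.

Lemma lebesgue_cons_sigma_finite : sigma_finite setT lebesgue_cons.
Proof.
have /sigma_finiteP[F [TF ndF Foo]] := sigma_finiteT (@lebesgue_measure R).
have /sigma_finiteP[G [TG ndG Goo]] := sigma_finiteT mu.
exists (fun k => unconsrV @^-1` (F k `*` G k)).
  rewrite -preimage_bigcup (_ : \bigcup_k _ = setT) ?preimage_setT//.
  rewrite -subTset => -[x y] _.
  have [i _ Fx] : (\bigcup_k F k) x by rewrite -TF.
  have [j _ Gy] : (\bigcup_k G k) y by rewrite -TG.
  exists (maxn i j) => //; split.
  - by move: x Fx; exact/subsetPset/ndF/leq_maxl.
  - by move: y Gy; exact/subsetPset/ndG/leq_maxr.
move=> k; have [mF Fk] := Foo k; have [mG Gk] := Goo k; split.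
  rewrite -[X in measurable X]setTI; apply: measurable_unconsrV => //.
  exact: measurableX.
rewrite /lebesgue_cons /pushforward -comp_preimage.
rewrite (_ : unconsrV \o consrV = id); last first.
  by apply/funext => p; exact: consrVK.
by rewrite preimage_id product_measure1E// lte_mul_pinfty// ge0_fin_numE.
Qed.

HB.instance Definition _ := Measure_isSigmaFinite.Build _ _ _
  lebesgue_cons lebesgue_cons_sigma_finite.

End lebesgue_rV_step.

(* The n-fold product of the one-dimensional Lebesgue measure,
   transported to row vectors; R^0 is a point of mass 1. *)
Fixpoint lebesgue_rV (R : realType) (n : nat) :
    {sigma_finite_measure set 'rV[R]_n -> \bar R} :=
  if n is k.+1 then lebesgue_cons (lebesgue_rV R k) else \d_(0 : 'rV[R]_0).

Section euclidean.
Context {R : realType} {d : nat}.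
Implicit Types (A : set 'rV[R]_d) (x y : 'rV[R]_d) (p : 'rV[R]_d * 'rV[R]_d).

Definition enorm x : R := Num.sqrt (\sum_(j < d) x ord0 j ^+ 2).

Definition dist_to A y : R := inf [set enorm (y - a) | a in A].

Definition parallel_set A (e : R) : set 'rV[R]_d := [set x | dist_to A x <= e].

Definition nearest A y : set 'rV[R]_d := [set x | A x /\ enorm (y - x) = dist_to A y].

Definition Unp A : set 'rV[R]_d :=
  [set y | ~ A y /\ exists x, nearest A y = [set x]].

Definition metric_proj A y : 'rV[R]_d := get (nearest A y).

Definition normal_bundle A : set ('rV[R]_d * 'rV[R]_d) :=
  [set (metric_proj A y, (dist_to A y)^-1 *: (y - metric_proj A y)) | y in Unp A].

(* "pi_A (x + t u) = x" is read as "x is the only nearest point of x + t u":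
   pi_A is not defined at points without a unique nearest point, and at t = 0
   the point x + t u = x lies in A. *)
Definition local_reach A p : \bar R :=
  ereal_sup [set t%:E | t in
    [set t : R | 0 <= t /\ nearest A (p.1 + t *: p.2) = [set p.1]]].

Definition reach_gt A (t : R) : set ('rV[R]_d * 'rV[R]_d) :=
  [set p | (t%:E < local_reach A p)%E].

End euclidean.

Section constants.
Context (R : realType).

Definition Gamma (x : R) : R :=
  \int[@lebesgue_measure R]_(t in `]0, +oo[) (t `^ (x - 1) * expR (- t)).

Definition kappa (k : nat) : R := pi `^ (k%:R / 2) / Gamma (k%:R / 2 + 1).

Definition omega (k : nat) : R := k%:R * kappa k.

Definition steiner_coef (d i j : nat) : R :=
  'C(d - j, d - i)%:R * (kappa (d - j) / kappa (d - i)).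

End constants.

Section signed_measure.
Context {disp : measure_display} {T : measurableType disp} {R : realType}.
Local Open Scope ereal_scope.

(* Unlike for the library's charges, both parts may have infinite mass. *)
Record signed_measure := SignedMeasure {
  pos_part : {sigma_finite_measure set T -> \bar R} ;
  neg_part : {sigma_finite_measure set T -> \bar R} ;
  parts_singular : exists B : set T,
    [/\ measurable B, pos_part (~` B) = 0 & neg_part B = 0]
}.

Definition variation_measure (mu : signed_measure) :
    {measure set T -> \bar R} :=
  measure_add (pos_part mu) (neg_part mu).

(* The integral and the total mass are meaningful when they are not of the
   form +oo - +oo; the library sets this difference to -oo. *)
Definition signed_integral (mu : signed_measure) (D : set T) (f : T -> \bar R)
    : \bar R :=
  \int[pos_part mu]_(x in D) f x - \int[neg_part mu]_(x in D) f x.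

Definition total_mass (mu : signed_measure) : \bar R :=
  pos_part mu setT - neg_part mu setT.

End signed_measure.
Arguments signed_measure {disp} T R.

Section support_measures.
Context {R : realType} {d : nat}.
Local Notation Rd := 'rV[R]_d.
Local Open Scope ereal_scope.
Implicit Types (A : set Rd) (mu : 'I_d -> signed_measure (Rd * Rd)%type R).

Definition concentrated_on_bundle A mu : Prop :=
  forall i, variation_measure (mu i) (~` normal_bundle A) = 0.

Definition locally_integrable_reach A mu : Prop :=
  forall (i : 'I_d) (B : set Rd) (r : R), compact B -> (0 < r)%R ->
    \int[variation_measure (mu i)]_(p in normal_bundle A)
      ((\1_B p.1)%:E * mine r%:E (local_reach A p) ^+ (d - i)) < +oo.

Definition local_steiner_formula A mu : Prop :=
  forall f : Rd -> R, measurable_fun setT f ->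
    (exists M : R, forall x, (`|f x| <= M)%R) ->
    compact (closure [set x | f x != 0%R]) ->
    \int[lebesgue_rV R d]_(x in ~` A) (f x)%:E =
    \sum_(i < d) ((omega R (d - i))%:E *
      \int[@lebesgue_measure R]_(t in `]0%R, +oo[)
        signed_integral (mu i) (normal_bundle A) (fun p =>
          (t ^+ (d - i - 1) * \1_(reach_gt A t) p
            * f (p.1 + t *: p.2))%:E)).

(* Measures on R^d x S^(d-1) are represented by measures on R^d x R^d; the
   first condition makes them vanish outside R^d x S^(d-1). *)
Definition is_support_measures A mu : Prop :=
  [/\ concentrated_on_bundle A mu, locally_integrable_reach A mu
    & local_steiner_formula A mu].

Definition basic_function A mu (i : 'I_d) (t : R) : \bar R :=
  signed_integral (mu i) (normal_bundle A)
    (fun p => (\1_(reach_gt A t) p)%:E).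

(* In the next three definitions the content exists (in R) and equals m. *)
Definition has_basic_content A mu (q : R) (i : 'I_d) (m : R) : Prop :=
  (t `^ (q - i%:R))%:E * basic_function A mu i t @[t --> 0%R^'+] --> m%:E.

Definition has_support_content A
    (mu : set Rd -> 'I_d -> signed_measure (Rd * Rd)%type R)
    (q : R) (i : 'I_d) (m : R) : Prop :=
  (e `^ (q - i%:R))%:E * total_mass (mu (parallel_set A e) i)
    @[e --> 0%R^'+] --> m%:E.

Definition has_outer_Minkowski_content A (q m : R) : Prop :=
  (e `^ (q - d%:R))%:E * lebesgue_rV R d (parallel_set A e `\` A)
    @[e --> 0%R^'+] --> m%:E.

End support_measures.

(* Main.v *)
Require Import Defs.
From mathcomp Require Import all_boot all_order all_algebra.
From mathcomp Require Import all_classical all_reals all_analysis.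
From mathcomp Require Import measurable_realfun zify ring lra.

(** Fix r > 0 and let N_r(B) be the set of pairs (x, u) in the normal bundle of
    the compact set B whose local reach is at least r.  For 0 < b < r the local
    Steiner formula, applied to the indicator of the tube
    {x + t u : (x, u) in G and N_r(B), 0 < t <= b}, says that the volume of the
    tube is the polynomial sum_i kappa_(d-i) b^(d-i) mu_i(B; G and N_r(B)).
    A tube over the parallel set A_e is the difference of two tubes over A, of
    lengths b + e and e.  Comparing the coefficients of b gives
    mu_i(A_e; G and N_r(A_e)) as a combination of masses of mu_j(A) with j <= i,
    with coefficients c_ij e^(i-j).  Taking for G the two halves of a Hahn
    decomposition bounds |mu_i(A_e)| uniformly in r, and then r -> 0 yields
    mu_i(A_e) = sum_(j <= i) c_ij e^(i-j) beta_j(A; e), hence the support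
    contents.
    The Steiner formula for the indicator of A_e minus A expresses the outer
    volume as sum_j omega_(d-j) int_0^e t^(d-j-1) beta_j(A; t) dt.  If q < d the
    integrand is asymptotic to M_j t^(d-q-1).  If q > d then all M_j vanish,
    because t^(d-j) |mu_j|(delta > t) stays bounded, and the factor e^(q-d)
    kills the outer volume. *)

Set Implicit Arguments.
Unset Strict Implicit.
Unset Printing Implicit Defensive.

Import Order.TTheory GRing.Theory Num.Theory.
Import numFieldNormedType.Exports.

Local Open Scope classical_set_scope.
Local Open Scope ring_scope.

(** * Euclidean norm *)

Section euclidean_norm.
Context {R : realType} {d : nat}.
Implicit Types (x y z u v : 'rV[R]_d).

Definition dotv x y : R := \sum_(j < d) x ord0 j * y ord0 j.

Lemma dotvC x y : dotv x y = dotv y x.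
Proof. by apply: eq_bigr => j _; rewrite mulrC. Qed.

Lemma dotvDl x y z : dotv (x + y) z = dotv x z + dotv y z.
Proof. by rewrite -big_split; apply: eq_bigr => j _; rewrite mxE mulrDl. Qed.

Lemma dotvZl (a : R) x y : dotv (a *: x) y = a * dotv x y.
Proof. by rewrite mulr_sumr; apply: eq_bigr => j _; rewrite mxE mulrA. Qed.

Lemma dotvDr x y z : dotv z (x + y) = dotv z x + dotv z y.
Proof. by rewrite dotvC dotvDl !(dotvC z). Qed.

Lemma dotvZr (a : R) x y : dotv x (a *: y) = a * dotv x y.
Proof. by rewrite dotvC dotvZl dotvC. Qed.

Lemma dotvv_ge0 x : 0 <= dotv x x.
Proof. by apply: sumr_ge0 => j _; rewrite -expr2 sqr_ge0. Qed.

Lemma dotvv_eq0 x : dotv x x = 0 -> x = 0.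
Proof.
move=> /eqP; rewrite psumr_eq0 => [/allP h|j _]; last by rewrite -expr2 sqr_ge0.
apply/rowP => j; have := h j; rewrite mem_index_enum => /(_ isT).
by rewrite -expr2 sqrf_eq0 mxE => /eqP.
Qed.

Lemma enorm_ge0 x : 0 <= enorm x. Proof. exact: sqrtr_ge0. Qed.

Lemma enorm_sqr x : enorm x ^+ 2 = dotv x x.
Proof.
rewrite sqr_sqrtr; first by apply: eq_bigr => j _; rewrite expr2.
by apply: sumr_ge0 => j _; rewrite sqr_ge0.
Qed.

Lemma enorm_eq0 x : enorm x = 0 -> x = 0.
Proof. by move=> x0; apply: dotvv_eq0; rewrite -enorm_sqr x0 expr0n. Qed.

Lemma enorm0 : enorm (0 : 'rV[R]_d) = 0.
Proof. by rewrite /enorm big1 ?sqrtr0// => j _; rewrite mxE expr0n. Qed.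

Lemma enormZ (a : R) x : enorm (a *: x) = `|a| * enorm x.
Proof.
apply/eqP; rewrite -(@eqrXn2 _ 2)// ?mulr_ge0 ?enorm_ge0//.
by rewrite exprMn !enorm_sqr dotvZl dotvZr real_normK ?num_real// expr2 mulrA.
Qed.

Lemma enormN x : enorm (- x) = enorm x.
Proof. by rewrite -scaleN1r enormZ normrN1 mul1r. Qed.

Lemma dotv_le_enorm x y : dotv x y <= enorm x * enorm y.
Proof.
have [x0|x0] := eqVneq (enorm x) 0.
  rewrite (enorm_eq0 x0) enorm0 mul0r /dotv big1// => j _.
  by rewrite mxE mul0r.
have [y0|y0] := eqVneq (enorm y) 0.
  rewrite (enorm_eq0 y0) enorm0 mulr0 /dotv big1// => j _.
  by rewrite mxE mulr0.
have {}x0 : 0 < enorm x by rewrite lt0r x0 enorm_ge0.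
have {}y0 : 0 < enorm y by rewrite lt0r y0 enorm_ge0.
have E : dotv (enorm y *: x - enorm x *: y) (enorm y *: x - enorm x *: y) =
    2 * (enorm x * enorm y) * (enorm x * enorm y - dotv x y).
  rewrite -scaleNr !(dotvDl, dotvDr, dotvZl, dotvZr) -!enorm_sqr (dotvC y x).
  by ring.
have := dotvv_ge0 (enorm y *: x - enorm x *: y).
by rewrite E pmulr_rge0 ?subr_ge0// !mulr_gt0.
Qed.

Lemma enormD x y : enorm (x + y) <= enorm x + enorm y.
Proof.
rewrite -(@ler_pXn2r _ 2)// ?nnegrE ?addr_ge0 ?enorm_ge0//.
rewrite enorm_sqr sqrrD !enorm_sqr !(dotvDl, dotvDr) (dotvC y x).
by have := dotv_le_enorm x y; lra.
Qed.

Lemma enormB x y : enorm (x - y) = enorm (y - x).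
Proof. by rewrite -enormN opprB. Qed.

Lemma enormD_eq u v (s t : R) : enorm u = 1 -> 0 < s -> 0 <= t ->
  enorm v = t -> enorm (s *: u + v) = s + t -> v = t *: u.
Proof.
move=> u1 s0 t0 vt stE.
have /eqP : enorm (s *: u + v) ^+ 2 = (s + t) ^+ 2 by rewrite stE.
rewrite enorm_sqr !(dotvDl, dotvDr, dotvZl, dotvZr) -!enorm_sqr (dotvC v u).
rewrite u1 vt => /eqP h; have {}h : s * (dotv u v - t) = 0 by lra.
have {}h : dotv u v = t.
  by move/eqP: h; rewrite mulf_eq0 gt_eqF//= subr_eq0 => /eqP.
apply/eqP; rewrite -subr_eq0; apply/eqP/dotvv_eq0.
rewrite -scaleNr !(dotvDl, dotvDr, dotvZl, dotvZr) -!enorm_sqr (dotvC v u).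
by rewrite u1 vt h; ring.
Qed.

Lemma enorm_continuous : continuous (enorm : 'rV[R]_d -> R).
Proof.
have h : continuous (fun x : 'rV[R]_d => \sum_(j < d) x ord0 j ^+ 2).
  apply: continuous_big => [|j _ x]; first exact: add_continuous.
  apply: (@continuous_comp _ _ _ (fun x => x ord0 j) (fun t : R => t ^+ 2)).
    exact: coord_continuous.
  exact: exprn_continuous.
by move=> x; apply: continuous_comp; [exact: h|exact: sqrt_continuous].
Qed.

Lemma normr_le_enorm x : `|x| <= enorm x.
Proof.
rewrite [leLHS](mx_normrE x); apply/bigmax_leP; split=> [|[i j] _] /=.
  exact: enorm_ge0.
rewrite ord1 -(@ler_pXn2r _ 2)// ?nnegrE ?enorm_ge0// enorm_sqr.
rewrite real_normK ?num_real// /dotv (bigD1 j)//= -expr2 lerDl.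
by apply: sumr_ge0 => k _; rewrite -expr2 sqr_ge0.
Qed.

End euclidean_norm.

(** * Distance function and local reach *)

Section distance.
Context {R : realType} {d : nat} (B : set 'rV[R]_d).
Hypothesis (B0 : B !=set0) (cB : compact B).
Implicit Types (x y z a : 'rV[R]_d) (e : R).

Let dist_inf y : has_inf [set enorm (y - a) | a in B].
Proof.
split; first by have [a Ba] := B0; exists (enorm (y - a)), a.
by exists 0 => _ [a _ <-]; exact: enorm_ge0.
Qed.

Lemma dist_to_ge0 y : 0 <= dist_to B y.
Proof.
by apply: lb_le_inf;
  [exact: (dist_inf y).1|move=> _ [a _ <-]; exact: enorm_ge0].
Qed.

Lemma dist_to_le y a : B a -> dist_to B y <= enorm (y - a).
Proof. by move=> Ba; apply: ge_inf; [exact: (dist_inf y).2|exists a]. Qed.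

Lemma enorm_sub_continuous y : continuous (fun a => enorm (y - a)).
Proof.
move=> a; apply: (@continuous_comp _ _ _ (fun a => y - a) enorm).
  by apply: continuousB; [exact: cst_continuous|exact: cvg_id].
exact: enorm_continuous.
Qed.

Lemma nearest_exists y : exists a, nearest B y a.
Proof.
have cf : {within B, continuous (fun a => enorm (y - a))}.
  by apply: continuous_subspaceT; exact: enorm_sub_continuous.
have [a /set_mem Ba amin] := EVT_min_rV B0 cB cf.
exists a; split => //; apply/eqP; rewrite eq_le dist_to_le// andbT.
apply: lb_le_inf; first exact: (dist_inf y).1.
by move=> _ [b Bb <-]; apply: amin; exact: mem_set.
Qed.

Lemma dist_to_lipschitz x y : dist_to B x <= dist_to B y + enorm (x - y).
Proof.
have [a [Ba <-]] := nearest_exists y.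
rewrite (le_trans (dist_to_le _ Ba))// [leRHS]addrC.
by rewrite (le_trans _ (enormD _ _))// addrA subrK.
Qed.

Lemma dist_to_eq0 y : (dist_to B y = 0) <-> B y.
Proof.
split=> [y0|By].
  have [a [Ba]] := nearest_exists y; rewrite y0 => /enorm_eq0/eqP.
  by rewrite subr_eq0 => /eqP ->.
apply/eqP; rewrite eq_le dist_to_ge0 andbT.
by rewrite (le_trans (dist_to_le y By))// subrr enorm0.
Qed.

Lemma dist_to_continuous : continuous (dist_to B).
Proof.
move=> y; rewrite /continuous_at; apply/(@cvgrPdist_lt _ _ _ (nbhs y)) => e e0.
move/cvgrPdist_lt : (@enorm_sub_continuous y y) => /(_ e e0).
apply: filterS => z.
rewrite subrr enorm0 sub0r normrN ger0_norm ?enorm_ge0// => h.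
rewrite (le_lt_trans _ h)// ler_distl.
have := dist_to_lipschitz y z; have := dist_to_lipschitz z y.
by rewrite (enormB z y) lerBlDr => -> ->.
Qed.

Lemma parallel_set_sub e : 0 <= e -> B `<=` parallel_set B e.
Proof. by move=> e0 x /dist_to_eq0 x0; rewrite /parallel_set /= x0. Qed.

Lemma parallel_set_neq0 e : 0 <= e -> parallel_set B e !=set0.
Proof. by have [b Bb] := B0; exists b; exact: parallel_set_sub Bb. Qed.

Lemma closed_parallel_set e : closed (parallel_set B e).
Proof.
have -> : parallel_set B e = dist_to B @^-1` [set x | x <= e] by [].
by apply: closed_comp => [x _|]; [exact: dist_to_continuous|exact: closed_le].
Qed.

Lemma compact_parallel_set e : compact (parallel_set B e).
Proof.
apply: bounded_closed_compact; last exact: closed_parallel_set.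
have [M [Mr BM]] := compact_bounded cB.
exists (M + 1 + e); split; first exact: num_real.
move=> k Mk x /= xe; have [a [Ba axe]] := nearest_exists x.
have h1 : `|x - a| <= e by rewrite (le_trans (normr_le_enorm _))// axe.
have h2 : `|a| <= M + 1 by apply: BM => //; rewrite ltrDl.
rewrite -[x](subrK a) (le_trans (ler_normD _ _))// (le_trans (lerD h1 h2))//.
by rewrite addrC ltW.
Qed.

Lemma dist_to_parallel e z : 0 <= e -> e <= dist_to B z ->
  dist_to (parallel_set B e) z = dist_to B z - e.
Proof.
move=> e0 ez; apply/eqP; rewrite eq_le; apply/andP; split; last first.
  apply: lb_le_inf.
    have [b Bb] := B0; exists (enorm (z - b)), b => //.
    exact: parallel_set_sub Bb.
  move=> _ [y ye <-]; rewrite lerBlDl.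
  by rewrite (le_trans (dist_to_lipschitz z y))// lerD2r.
have [a [Ba az]] := nearest_exists z.
have [z0|z0] := eqVneq (dist_to B z) 0.
  have e00 : e = 0 by apply/eqP; rewrite eq_le e0 -z0 ez.
  rewrite z0 e00 subr0; have /dist_to_eq0 Bz := z0.
  apply: ge_inf; first by exists 0 => _ [b _ <-]; exact: enorm_ge0.
  by exists z; [rewrite /parallel_set/= z0|rewrite subrr enorm0].
have {}z0 : 0 < dist_to B z by rewrite lt0r z0 dist_to_ge0.
pose y := a + (e / dist_to B z) *: (z - a).
have ye : dist_to B y <= e.
  rewrite (le_trans (dist_to_le _ Ba))// /y addrC addKr enormZ az.
  by rewrite ger0_norm ?divfK ?gt_eqF// divr_ge0// ltW.
apply: ge_inf; first by exists 0 => _ [b _ <-]; exact: enorm_ge0.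
exists y => //.
have -> : z - y = (1 - e / dist_to B z) *: (z - a).
  by rewrite scalerBl scale1r /y opprD addrA.
rewrite enormZ az ger0_norm ?subr_ge0 ?ler_pdivrMr ?mul1r//.
by rewrite mulrBl mul1r divfK// gt_eqF.
Qed.

End distance.

Section reach.
Context {R : realType} {d : nat}.
Implicit Types (B : set 'rV[R]_d) (x y u : 'rV[R]_d) (p : 'rV[R]_d * 'rV[R]_d).

(* For [r > 0] this is the set of all [(x, u)] in the normal bundle with local
   reach at least [r]; in this form it is visibly closed. *)
Definition reach_ge B (r : R) : set ('rV[R]_d * 'rV[R]_d) :=
  [set p | [/\ B p.1, enorm p.2 = 1 & dist_to B (p.1 + r *: p.2) = r]].

Section compact_base.
Variable B : set 'rV[R]_d.
Hypothesis (B0 : B !=set0) (cB : compact B).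

Lemma reach_ge_le s t : 0 <= t -> t <= s -> reach_ge B s `<=` reach_ge B t.
Proof.
move=> t0 ts [x u] [/= Bx u1 xs]; split => //=.
apply/eqP; rewrite eq_le; apply/andP; split.
  rewrite (le_trans (dist_to_le _ _ Bx))//.
  by rewrite addrAC subrr add0r enormZ u1 mulr1 ger0_norm.
have := dist_to_lipschitz B0 cB (x + s *: u) (x + t *: u).
rewrite xs opprD addrACA subrr add0r -scalerBl enormZ u1 mulr1.
by rewrite ger0_norm ?subr_ge0//; lra.
Qed.

Lemma dist_reach_ge s t x u : 0 <= t -> t <= s -> reach_ge B s (x, u) ->
  dist_to B (x + t *: u) = t.
Proof. by move=> t0 ts /(reach_ge_le t0 ts) []. Qed.

Lemma nearest_reach_ge s t x u : 0 <= t -> t < s -> reach_ge B s (x, u) ->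
  nearest B (x + t *: u) = [set x].
Proof.
move=> t0 ts xs; have xt := dist_reach_ge t0 (ltW ts) xs.
have [/= Bx u1 dxs] := xs.
apply/seteqP; split => [a [Ba]|_ ->]; last first.
  by split => //; rewrite xt addrAC subrr add0r enormZ u1 mulr1 ger0_norm.
rewrite xt => at_; have st0 : 0 < s - t by rewrite subr_gt0.
have E : (s - t) *: u + (x + t *: u - a) = x + s *: u - a.
  by apply/rowP => j; rewrite !mxE; ring.
have h : enorm ((s - t) *: u + (x + t *: u - a)) = (s - t) + t.
  apply/eqP; rewrite eq_le; apply/andP; split.
    rewrite (le_trans (enormD _ _))// enormZ u1 mulr1 at_ ger0_norm//.
    exact: ltW.
  by rewrite subrK E -{1}dxs; exact: dist_to_le.
have := enormD_eq u1 st0 t0 at_ h.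
by rewrite addrAC => /eqP; rewrite -subr_eq0 addrK subr_eq0 => /eqP.
Qed.

Lemma nearest1_reach_ge s x u : 0 <= s -> enorm u = 1 ->
  nearest B (x + s *: u) = [set x] -> reach_ge B s (x, u).
Proof.
move=> s0 u1 xs; have [Bx] : nearest B (x + s *: u) x by rewrite xs.
by rewrite addrAC subrr add0r enormZ u1 mulr1 ger0_norm// => sE; split.
Qed.

Lemma metric_proj_nearest1 y x : nearest B y = [set x] -> metric_proj B y = x.
Proof. by move=> yx; rewrite /metric_proj yx; exact: get_unique. Qed.

Lemma normal_bundleP p :
  normal_bundle B p <-> exists2 s, 0 < s & reach_ge B s p.
Proof.
split=> [[y [nBy [x xy] <-]]|].
  have yx := metric_proj_nearest1 xy.
  have [Bx dxy] : nearest B y x by rewrite xy.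
  have y0 : 0 < dist_to B y.
    by rewrite lt0r dist_to_ge0// andbT; apply/eqP => /(dist_to_eq0 B0 cB).
  exists (dist_to B y) => //; rewrite yx; split => //=.
    by rewrite enormZ dxy ger0_norm ?mulVf ?gt_eqF// invr_ge0 ltW.
  by rewrite scalerA mulfV ?gt_eqF// scale1r addrCA subrr addr0.
case: p => x u [s s0 xs]; have [_ /= u1 _] := xs.
have s20 : 0 < s / 2 by rewrite divr_gt0.
have s2s : s / 2 < s by rewrite gtr_pMr// invf_lt1// ltr1n.
have D := dist_reach_ge (ltW s20) (ltW s2s) xs.
have N := nearest_reach_ge (ltW s20) s2s xs.
exists (x + (s / 2) *: u).
  split; last by exists x.
  by move=> /(dist_to_eq0 B0 cB); rewrite D => /eqP; rewrite gt_eqF.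
rewrite (metric_proj_nearest1 N) D addrAC subrr add0r scalerA mulVf ?scale1r//.
by rewrite gt_eqF.
Qed.

Lemma reach_gtP t p : normal_bundle B p -> 0 <= t ->
  reach_gt B t p <-> exists2 s, t < s & reach_ge B s p.
Proof.
case: p => x u /normal_bundleP[s0 s00 [_ /= u1 _]] t0; split.
  move=> /ereal_sup_gt[_ [s [s0' sn] <-]]; rewrite lte_fin => ts.
  by exists s => //; exact: nearest1_reach_ge.
move=> [s ts xs]; pose m := (s + t) / 2.
have tm : t < m by rewrite /m; lra.
have ms : m < s by rewrite /m; lra.
have m0 : 0 <= m by rewrite (le_trans t0)// ltW.
apply: (@lt_le_trans _ _ m%:E); first by rewrite lte_fin.
apply: ereal_sup_ubound; exists m => //; split => //=.
exact: nearest_reach_ge xs.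
Qed.

Lemma reach_ge_parallel e r y u : 0 < e -> 0 < r ->
  reach_ge (parallel_set B e) r (y, u) <-> reach_ge B (r + e) (y - e *: u, u).
Proof.
move=> e0 r0.
have yE : y - e *: u + (r + e) *: u = y + r *: u.
  by rewrite scalerDl [r *: u + _]addrC addrA subrK.
split=> [[/= ye u1 dy]|[/= By u1]]; last first.
  rewrite yE => dy; split => //=.
    rewrite /parallel_set/=; have ee : e <= r + e by rewrite lerDr ltW.
    have := @dist_reach_ge (r + e) e (y - e *: u) u (ltW e0) ee.
    by rewrite subrK => ->//; split => //=; rewrite yE.
  rewrite dist_to_parallel// ?dy ?addrK//; first exact: ltW.
  by rewrite lerDr ltW.
have {}dy : dist_to B (y + r *: u) = r + e.
  have [h|h] := leP e (dist_to B (y + r *: u)).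
    have /eqP := dy; rewrite (dist_to_parallel B0 cB (ltW e0) h).
    by rewrite subr_eq => /eqP.
  have : dist_to (parallel_set B e) (y + r *: u) = 0.
    have P0 := parallel_set_neq0 B0 cB (ltW e0).
    apply: (dist_to_eq0 P0 (@compact_parallel_set _ _ _ B0 cB e) _).2.
    exact: ltW.
  by rewrite dy => rr; rewrite rr ltxx in r0.
have lip : dist_to B (y + r *: u) <= dist_to B y + r.
  rewrite (le_trans (dist_to_lipschitz B0 cB _ y))// addrAC subrr add0r.
  by rewrite enormZ u1 mulr1 ger0_norm// ltW.
have {}ye : dist_to B y = e.
  by apply/eqP; rewrite eq_le ye/= -(lerD2r r) (le_trans _ lip)// dy addrC.
have [a [Ba ya]] := nearest_exists B0 cB y.
have h : enorm (r *: u + (y - a)) = r + e.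
  apply/eqP; rewrite eq_le; apply/andP; split.
    by rewrite (le_trans (enormD _ _))// enormZ u1 mulr1 ya ye ger0_norm// ltW.
  by rewrite -{1}dy addrA [r *: u + y]addrC; exact: dist_to_le.
have {}ya : enorm (y - a) = e by rewrite ya ye.
have yaE := enormD_eq u1 r0 (ltW e0) ya h.
have aE : a = y - e *: u by rewrite -yaE opprB addrC subrK.
by rewrite -aE; split => //=; rewrite aE yE.
Qed.

End compact_base.
End reach.

(** * Tubes *)

Section borel_sets.
Context {R : realType} {d : nat}.
Implicit Types (U C : set 'rV[R]_d) (f : 'rV[R]_d -> R).

Lemma open_measurable_rV U : open U -> measurable U.
Proof. by move=> oU; exact: sub_sigma_algebra. Qed.

Lemma closed_measurable_rV C : closed C -> measurable C.
Proof.
move=> cC; rewrite -[C]setCK; apply: measurableC.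
by apply: open_measurable_rV; exact: closed_openC.
Qed.

Lemma compact_measurable_rV C : compact C -> measurable C.
Proof.
by move=> cC; apply: closed_measurable_rV; exact: compact_closed.
Qed.

Lemma continuous_measurable_rV f : continuous f -> measurable_fun setT f.
Proof.
move=> cf; apply: (@measurability _ _ _ _ _ _ (@RGenOpens.G R)).
  exact: RGenOpens.measurableE.
move=> _ [_ [a [b ->] <-]]; rewrite setTI; apply: open_measurable_rV.
by apply: open_comp => [x _|]; [exact: cf|exact: interval_open].
Qed.

Lemma measurable_fun_rV_closed (D : set 'rV[R]_d) (g : 'rV[R]_d -> 'rV[R]_d) :
  measurable D -> (forall C, closed C -> measurable (D `&` g @^-1` C)) ->
  measurable_fun D g.
Proof.
move=> mD mg; apply: (@measurability _ _ _ _ _ _ (@open 'rV[R]_d)) => //.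
move=> _ [U oU <-].
have -> : D `&` g @^-1` U = D `\` (D `&` g @^-1` (~` U)).
  apply/seteqP; split => x /= [Dx]; first by move=> Ux; split => // -[].
  by move=> h; split => //; apply: contrapT => nU; exact: h.
by apply: measurableD => //; apply: mg; exact: open_closedC.
Qed.

Lemma measurable_translate (r : R) : measurable_fun setT
  (fun p : 'rV[R]_d * 'rV[R]_d => p.1 + r *: p.2).
Proof.
apply: measurable_fun_rV => j; under eq_fun do rewrite !mxE.
apply: measurable_funD.
  exact: (measurableT_comp (measurable_coord j) measurable_fst).
apply: measurable_funM => //.
exact: (measurableT_comp (measurable_coord j) measurable_snd).
Qed.

End borel_sets.

Section tubes.
Context {R : realType} {d : nat}.
Implicit Types (B C : set 'rV[R]_d) (x y z u : 'rV[R]_d).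
Implicit Types (p : 'rV[R]_d * 'rV[R]_d) (G : set ('rV[R]_d * 'rV[R]_d)).

Let ray_continuous : continuous
  (fun z : 'rV[R]_d * 'rV[R]_d * R => z.1.1 + z.2 *: z.1.2).
Proof.
move=> z; apply: (@cvgD _ _ _ _ _ (fun z : 'rV[R]_d * 'rV[R]_d * R => z.1.1)
  (fun z : 'rV[R]_d * 'rV[R]_d * R => z.2 *: z.1.2)).
  by apply: (@continuous_comp _ _ _ fst fst); exact: cvg_fst.
apply: cvgZ; first exact: cvg_snd.
by apply: (@continuous_comp _ _ _ fst snd); [exact: cvg_fst|exact: cvg_snd].
Qed.

Definition tube B r G (b : R) : set 'rV[R]_d :=
  [set z | exists p t,
    [/\ reach_ge B r p, G p, 0 < t <= b & z = p.1 + t *: p.2]].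

Section compact_base.
Variable B : set 'rV[R]_d.
Hypothesis (B0 : B !=set0) (cB : compact B).

Let reach_geE r : reach_ge B r =
  [set p | B p.1] `&` [set p | enorm p.2 = 1] `&`
  [set p | dist_to B (p.1 + r *: p.2) = r].
Proof.
by apply/seteqP; split => p /=; [move=> [? ? ?]|move=> [[? ?] ?]].
Qed.

Lemma measurable_reach_ge r : measurable (reach_ge B r).
Proof.
rewrite reach_geE.
have mset1 (f : 'rV[R]_d * 'rV[R]_d -> R) (c : R) : measurable_fun setT f ->
    measurable [set p | f p = c].
  move=> mf; rewrite (_ : [set p | _] = setT `&` f @^-1` [set c]).
    exact: mf.
  by rewrite setTI.
apply: measurableI; first apply: measurableI.
- rewrite -[X in measurable X]setTI; apply: measurable_fst => //.
  exact: compact_measurable_rV.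
- apply: mset1; apply: measurableT_comp measurable_snd.
  apply: continuous_measurable_rV; exact: enorm_continuous.
- apply: mset1; apply: measurableT_comp (measurable_translate r).
  by apply: continuous_measurable_rV; exact: dist_to_continuous.
Qed.

Lemma normal_bundleE :
  normal_bundle B = \bigcup_n reach_ge B n.+1%:R^-1.
Proof.
apply/seteqP; split => p.
  move=> /(normal_bundleP B0 cB)[s s0 ps].
  have [n] := ltr_add_invr s0; rewrite add0r => ns.
  by exists n => //; apply: (reach_ge_le B0 cB _ _ ps); rewrite ?invr_ge0// ltW.
by move=> [n _ pn]; apply/(normal_bundleP B0 cB); exists n.+1%:R^-1.
Qed.

Lemma measurable_normal_bundle : measurable (normal_bundle B).
Proof.
rewrite normal_bundleE; apply: bigcupT_measurable => n.
exact: measurable_reach_ge.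
Qed.

Lemma reach_gtE t : 0 <= t ->
  normal_bundle B `&` reach_gt B t = \bigcup_n reach_ge B (t + n.+1%:R^-1).
Proof.
move=> t0; apply/seteqP; split => p.
  move=> [Np] /(reach_gtP B0 cB Np t0)[s s0 ps].
  have [n ns] : exists n, t + n.+1%:R^-1 < s by exact: ltr_add_invr s0.
  exists n => //; apply: (reach_ge_le B0 cB _ _ ps); last exact: ltW.
  by rewrite addr_ge0 ?invr_ge0.
move=> [n _ pn].
have Np : normal_bundle B p.
  by apply/(normal_bundleP B0 cB);
    exists (t + n.+1%:R^-1) => //; exact: ltr_wpDl.
split => //; apply/(reach_gtP B0 cB Np t0); exists (t + n.+1%:R^-1) => //.
by rewrite ltrDl.
Qed.

Lemma measurable_reach_gt t : 0 <= t ->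
  measurable (normal_bundle B `&` reach_gt B t).
Proof.
move=> t0; rewrite reach_gtE//; apply: bigcupT_measurable => n.
exact: measurable_reach_ge.
Qed.

Lemma compact_reach_ge r : compact (reach_ge B r).
Proof.
have cE : compact [set u : 'rV[R]_d | enorm u = 1].
  apply: bounded_closed_compact.
    exists 1; split; first exact: num_real.
    by move=> k k1 x /= x1; rewrite (le_trans (normr_le_enorm x))// x1 ltW.
  rewrite (_ : [set u | _] = enorm @^-1` [set 1])//.
  by apply: closed_comp => [x _|]; [exact: enorm_continuous|exact: closed_eq].
apply: (subclosed_compact _ (compact_setX cB cE)); last by move=> p [].
rewrite reach_geE.
have c1 : closed B by apply: compact_closed => //; exact: norm_hausdorff.
apply: closedI; first apply: closedI.
- by apply: (closed_comp (f := fst)) => // p _; exact: cvg_fst.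
- apply: (closed_comp (f := fun p => enorm p.2) (D := [set 1])).
    move=> p _; apply: (@continuous_comp _ _ _ snd enorm); first exact: cvg_snd.
    exact: enorm_continuous.
  exact: closed_eq.
- apply: (closed_comp (f := fun p => dist_to B (p.1 + r *: p.2))
    (D := [set r])).
    move=> p _; apply: (@continuous_comp _ _ _
      (fun p : 'rV[R]_d * 'rV[R]_d => p.1 + r *: p.2) (dist_to B)).
      apply: continuousD; first exact: cvg_fst.
      apply: (@continuous_comp _ _ _ snd (fun x => r *: x)).
        exact: cvg_snd.
      exact: scaler_continuous.
    exact: dist_to_continuous.
  exact: closed_eq.
Qed.

Lemma measurable_tube_closed r G b : closed G -> measurable (tube B r G b).
Proof.
move=> cG; pose K (a : R) :=
  (fun z : 'rV[R]_d * 'rV[R]_d * R => z.1.1 + z.2 *: z.1.2) @`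
  ((reach_ge B r `&` G) `*` [set` `[a, b]]).
have -> : tube B r G b = \bigcup_n K n.+1%:R^-1.
  apply/seteqP; split => [z [p [t [pr Gp /andP[t0 tb] ->]]]|].
    have [n] := ltr_add_invr t0; rewrite add0r => nt.
    exists n => //; exists (p, t) => //; split => //=.
    by rewrite in_itv/= tb ltW.
  move=> z [n _ [[p t] [/= [pr Gp]]]]; rewrite in_itv/= => /andP[nt tb] <-.
  by exists p, t; split => //; rewrite tb (lt_le_trans _ nt).
apply: bigcupT_measurable => n; apply: compact_measurable_rV.
apply: continuous_compact.
  by apply: continuous_subspaceT; exact: ray_continuous.
apply: compact_setX; last exact: segment_compact.
apply: (subclosed_compact _ (@compact_reach_ge r)) => [|p []//].
apply: closedI => //; apply: compact_closed; last exact: compact_reach_ge.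
exact: norm_hausdorff.
Qed.

Let foot z := (metric_proj B z, (dist_to B z)^-1 *: (z - metric_proj B z)).

Let footE r p t : 0 < t -> t < r -> reach_ge B r p -> foot (p.1 + t *: p.2) = p.
Proof.
case: p => x u t0 tr xr; rewrite /foot/=.
rewrite (metric_proj_nearest1 (nearest_reach_ge B0 cB (ltW t0) tr xr)).
rewrite (dist_reach_ge B0 cB (ltW t0) (ltW tr) xr) addrAC subrr add0r scalerA.
by rewrite mulVf ?scale1r// gt_eqF.
Qed.

Let tube_foot r G b : b < r ->
  tube B r G b = tube B r setT b `&` foot @^-1` G.
Proof.
move=> br; apply/seteqP; split => z.
  move=> [p [t [pr Gp tb ->]]]; split; first by exists p, t.
  have /andP[t0 {}tb] := tb.
  by rewrite /= (footE t0 (le_lt_trans tb br) pr).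
move=> [[p [t [pr _ tb zE]]]]; have /andP[t0 tb'] := tb.
rewrite /preimage/= {1}zE (footE t0 (le_lt_trans tb' br) pr) => Gp.
by exists p, t.
Qed.

(* For closed [G] the tube is sigma-compact; applied to closed cylinders, this
   shows that the map sending a point of the full tube to its base pair [(x, u)]
   is Borel, which yields every measurable [G]. *)
Lemma measurable_tube r G b :
  b < r -> measurable G -> measurable (tube B r G b).
Proof.
move=> br mG; rewrite tube_foot//; set D := tube B r setT b.
have mD : measurable D by apply: measurable_tube_closed; exact: closedT.
have m1 : measurable_fun D (fst \o foot).
  apply: measurable_fun_rV_closed => // C cC.
  rewrite comp_preimage -tube_foot//; apply: measurable_tube_closed.
  by apply: closed_comp cC => p _; exact: cvg_fst.
have m2 : measurable_fun D (snd \o foot).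
  apply: measurable_fun_rV_closed => // C cC.
  rewrite comp_preimage -tube_foot//; apply: measurable_tube_closed.
  by apply: closed_comp cC => p _; exact: cvg_snd.
have := measurable_fun_pair ((measurable_restrictT _ mD).1 m1)
  ((measurable_restrictT _ mD).1 m2).
move=> /(_ measurableT _ mG); rewrite setTI => /(measurableI _ _ mD).
congr measurable; apply/seteqP; split => z /= [Dz].
  by rewrite /patch !mem_set.
by rewrite /patch !mem_set//= -surjective_pairing.
Qed.

Lemma dist_tube r G b z : b < r -> tube B r G b z -> 0 < dist_to B z <= b.
Proof.
move=> br [[x u] [t [xr _ /andP[t0 tb] ->]]].
by rewrite (dist_reach_ge B0 cB (ltW t0) _ xr) ?t0// (le_trans tb)// ltW.
Qed.

Lemma tube_normal r G b t p : 0 < t -> b < r ->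
  normal_bundle B p -> reach_gt B t p ->
  tube B r G b (p.1 + t *: p.2) <-> [/\ reach_ge B r p, G p & t <= b].
Proof.
move=> t0 br Np /(reach_gtP B0 cB Np (ltW t0))[s ts ps].
split=> [[q [t' [qr Gq /andP[t'0 t'b] pq]]]|[pr Gp tb]]; last first.
  by exists p, t; split => //; rewrite t0.
have t'r : t' < r by rewrite (le_lt_trans t'b).
have pE := footE t0 ts ps; have qE := footE t'0 t'r qr.
have {qE}pE : p = q by rewrite -pE pq qE.
subst q; split => //; move: pq qr t'r ps.
case: p {Np Gq} => x u /= pq qr t'r ps.
rewrite -(dist_reach_ge B0 cB (ltW t0) (ltW ts) ps) pq.
by rewrite (dist_reach_ge B0 cB (ltW t'0) (ltW t'r) qr).
Qed.

Lemma tube_parallel e r G b : 0 < e -> 0 < r -> b < r ->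
  tube (parallel_set B e) r G b =
  tube B (r + e) [set p | G (p.1 + e *: p.2, p.2)] (b + e) `\`
  tube B (r + e) [set p | G (p.1 + e *: p.2, p.2)] e.
Proof.
move=> e0 r0 br; have re : e < r + e by rewrite ltrDr.
apply/seteqP; split => z.
  move=> [[y u] [s [/(reach_ge_parallel B0 cB _ _ e0 r0) yr Gyu]]].
  move=> /andP[s0 sb] ->.
  have E : y + s *: u = y - e *: u + (s + e) *: u.
    by apply/rowP => j; rewrite !mxE; ring.
  rewrite /= E; split.
    exists (y - e *: u, u), (s + e); split => //=; first by rewrite subrK.
    by rewrite addr_gt0//= lerD2r.
  move=> /(dist_tube re) /andP[_].
  rewrite (dist_reach_ge B0 cB _ _ yr); [|by rewrite addr_ge0 ?ltW|].
    by rewrite gerDr leNgt s0.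
  by rewrite lerD2r ltW// (le_lt_trans sb).
move=> [[[x u] [t [xr /= Gp /andP[t0 tb] zE]]] ntube].
have et : e < t.
  rewrite ltNge; apply/negP => te; apply: ntube.
  by exists (x, u), t; split => //=; rewrite t0.
exists (x + e *: u, u), (t - e); split => //=.
- by apply/(reach_ge_parallel B0 cB _ _ e0 r0); rewrite addrK.
- by rewrite subr_gt0 et lerBlDr.
- by rewrite zE; apply/rowP => j; rewrite !mxE; ring.
Qed.

End compact_base.
End tubes.

(** * One-dimensional integrals *)

Section one_dimensional_integrals.
Context {R : realType}.
Local Notation leb := (@lebesgue_measure R).
Implicit Types (p b t : R).

Lemma measurable_powR_itv p (D : set R) : measurable_fun D (fun t => t `^ p).
Proof. by apply: measurable_funTS; exact: measurable_powR. Qed.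

Lemma integral_powR p b : 0 < p -> 0 < b ->
  (\int[leb]_(t in `]0%R, b]) (t `^ (p - 1))%:E = (b `^ p / p)%:E)%E.
Proof.
move=> p0 b0; pose u n : R := b / n.+1%:R.
have u0 n : 0 < u n by rewrite divr_gt0.
have ule n m : (n <= m)%N -> u m <= u n.
  by move=> nm; rewrite ler_pM2l// lef_pV2 ?posrE// ler_nat.
have ucvg : u n @[n --> \oo] --> (0 : R).
  rewrite -(mulr0 b); apply: cvgM; first exact: cvg_cst.
  exact: cvg_harmonic.
have -> : `]0%R, b]%classic = \bigcup_n `[u n, b]%classic.
  apply/seteqP; split => t /=; last first.
    by move=> [n _] /=; rewrite !in_itv/= => /andP[/(lt_le_trans (u0 n)) -> ->].
  rewrite in_itv/= => /andP[t0 tb].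
  move/cvgrPdist_le : ucvg => /(_ t t0)[n _ /(_ n (leqnn n))].
  rewrite sub0r normrN ger0_norm ?(ltW (u0 _))// => nt.
  by exists n => //=; rewrite in_itv/= nt tb.
have ucvgp : (u n `^ p) @[n --> \oo] --> (0 : R).
  by have /cvg_at_rightP := powR_cvg0 p0; apply; split.
pose I n := (b `^ p / p - u n `^ p / p)%:E.
have <- : limn I = (b `^ p / p)%:E.
  apply/cvg_lim => //; apply: cvg_EFin; first exact: nearW.
  rewrite -[X in _ --> X]subr0 -[X in _ - X](mul0r p^-1).
  apply: cvgB; first exact: cvg_cst.
  by apply: cvgM => //; exact: cvg_cst.
apply/esym/cvg_lim => //.
have IE n : (\int[leb]_(t in `[u n, b]) (t `^ (p - 1))%:E)%E = I n.
  have pos t : t \in `[u n, b] -> 0 < t.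
    by rewrite in_itv/= => /andP[/(lt_le_trans (u0 n))].
  have [unb|] := ltP (u n) b; last first.
    move=> bu; have ub : u n = b.
      apply/eqP; rewrite eq_le bu andbT.
      by rewrite /u ler_pdivrMr// ler_peMr ?(ltW b0)// ler1n.
    by rewrite /I ub subrr set_itv1 integral_set1.
  have cp r t : 0 < t -> {for t, continuous (fun t : R => t `^ r)}.
    move=> t0; apply: differentiable_continuous.
    by apply/derivable1_diffP; apply: derivable_powR; rewrite in_itv/= t0.
  have cF t : 0 < t -> {for t, continuous (fun t : R => t `^ p / p)}.
    by move=> t0; apply: cvgM; [exact: cp|exact: cvg_cst].
  rewrite (@continuous_FTC2 _ _ (fun t => t `^ p / p))//.
  - apply: continuous_in_subspaceT => t /set_mem/= tu; apply: cp; exact: pos.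
  - split.
    + move=> t tu; apply: derivableM => //; apply: derivable_powR.
      by rewrite in_itv/= andbT pos//; apply: subset_itv_oo_cc.
    + by apply: cvg_at_right_filter; exact: cF.
    + by apply: cvg_at_left_filter; exact: cF.
  - move=> t tu; have t0 : 0 < t by apply: pos; exact: subset_itv_oo_cc.
    rewrite derive1E.
    have h := is_derive1_powR p t0.
    rewrite (_ : (fun t => t `^ p / p) =
        (p^-1 *: (fun t => t `^ p))); last first.
      by apply/funext => s; rewrite mulrC.
    rewrite deriveZ//=.
    by rewrite derive_val -[_ *: _]/(_ * _) mulrA mulVf ?mul1r// gt_eqF.
rewrite -(funext IE).
apply: ge0_nondecreasing_set_cvg_integral => //.
- move=> n m nm; rewrite subsetEset => t /=; rewrite !in_itv/= => /andP[nt ->].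
  by rewrite (le_trans (ule _ _ nm)).
- by move=> n; apply/measurable_EFinP; exact: measurable_powR_itv.
- by move=> n t _; rewrite lee_fin powR_ge0.
Qed.

Lemma integrable_powR p b : 0 < p -> 0 < b ->
  leb.-integrable `]0%R, b] (fun t => (t `^ (p - 1))%:E).
Proof.
move=> p0 b0; apply/integrableP; split.
  by apply/measurable_EFinP; exact: measurable_powR_itv.
under eq_integral do rewrite gee0_abs ?lee_fin ?powR_ge0//.
by rewrite integral_powR// ltry.
Qed.

Lemma integral_truncate (f : R -> \bar R) b : (forall t, b < t -> f t = 0%E) ->
  (\int[leb]_(t in `]0%R, +oo[) f t = \int[leb]_(t in `]0%R, b]) f t)%E.
Proof.
move=> fb; have -> : `]0%R, b]%classic = `]0%R, +oo[ `&` `]-oo, b].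
  apply/seteqP; split => t /=; rewrite !in_itv/= andbT; first by move=> /andP[].
  by move=> [-> ->].
rewrite integral_mkcondr; apply: eq_integral => t _; rewrite patchE.
case: ifPn => // /negP tb; apply: fb; rewrite ltNge; apply/negP => tb'.
by apply: tb; rewrite inE/= in_itv.
Qed.

Lemma powR_le_expR (n : nat) p t : 0 <= p <= n.+1%:R -> 0 <= t ->
  t `^ p <= (1 + 2 ^+ n.+1 * n.+1`!%:R) * expR (t / 2).
Proof.
move=> /andP[p0 pn] t0; have t20 : 0 <= t / 2 by rewrite divr_ge0.
have e1 : 1 <= expR (t / 2) by rewrite -[leLHS]expR0 ler_expR.
have [t1|t1] := leP t 1.
  rewrite (@le_trans _ _ 1)//.
    have <- : 1 `^ p = 1 by rewrite powR1.
    by rewrite ge0_ler_powR ?nnegrE.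
  rewrite -[leLHS]mulr1 ler_pM// lerDl.
  by rewrite mulr_ge0// exprn_ge0.
have := expR_ge1Dxn n t20.
have f0 : 0 < n.+1`!%:R :> R by rewrite ltr0n fact_gt0.
set e := expR _ in e1 *; move=> h.
have {}h : t ^+ n.+1 <= 2 ^+ n.+1 * n.+1`!%:R * e.
  have : t ^+ n.+1 / 2 ^+ n.+1 / n.+1`!%:R <= e.
    by rewrite -expr_div_n (le_trans _ h)// lerDr.
  by rewrite !ler_pdivrMr ?exprn_gt0// -mulrA mulrC [_ * 2 ^+ _]mulrC.
rewrite (@le_trans _ _ (t `^ n.+1%:R))//; first by rewrite ler_powR// ltW.
by rewrite powR_mulrn// (le_trans h)// ler_wpM2r ?lerDr// (le_trans _ e1).
Qed.

Lemma Gamma_gt0 p : 1 <= p -> 0 < Gamma p.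
Proof.
move=> p1; pose f (t : R) := t `^ (p - 1) * expR (- t).
rewrite /Gamma /Rintegral.
rewrite -[X in fine X]/(\int[leb]_(t in `]0%R, +oo[) (f t)%:E)%E.
apply: fine_gt0; have mf D : measurable_fun D (EFin \o f).
  apply/measurable_EFinP; apply: measurable_funM.
    exact: measurable_powR_itv.
  apply: measurable_funTS; apply: measurableT_comp => //.
have f0 t : (0 <= (f t)%:E)%E by rewrite lee_fin mulr_ge0 ?powR_ge0 ?expR_ge0.
apply/andP; split.
  apply: (@lt_le_trans _ _ (\int[leb]_(t in `[1%R, 2%R]) (expR (- 2))%:E)%E).
    rewrite integral_cst//= lebesgue_measure_itv/= lte_fin ltr1n.
    by rewrite -EFinB -EFinM lte_fin mulr_gt0 ?expR_gt0//; lra.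
  apply: (@le_trans _ _ (\int[leb]_(t in `[1%R, 2%R]) (f t)%:E)%E).
    apply: ge0_le_integral => //.
    - exact: mf.
    move=> t /=; rewrite in_itv/= lee_fin => /andP[t1 t2].
    rewrite -[leLHS]mul1r ler_pM ?expR_ge0// ?ler_expR ?lerN2//.
    by rewrite -[leLHS](powRr0 t) ler_powR ?subr_ge0.
  apply: ge0_subset_integral => //; first exact: mf.
  move=> t /=; rewrite !in_itv/= andbT => /andP[t1 _].
  by rewrite (lt_le_trans _ t1).
have [n pn] : exists n : nat, p - 1 <= n.+1%:R.
  exists (Num.truncn (p - 1)); apply: ltW; apply: truncnS_gt.
pose C : R := (1 + 2 ^+ n.+1 * n.+1`!%:R) * 2.
have C0 : 0 <= C by rewrite mulr_ge0// addr_ge0// mulr_ge0// exprn_ge0.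
apply: (@le_lt_trans _ _ (\int[leb]_t (C * exponential_pdf 2^-1 t)%:E)%E).
  apply: (@le_trans _ _
    (\int[leb]_(t in `]0%R, +oo[) (C * exponential_pdf 2^-1 t)%:E)%E).
    apply: ge0_le_integral => //; first exact: mf.
    - apply/measurable_EFinP; apply: measurable_funM => //.
      by apply: measurable_funTS; exact: measurable_exponential_pdf.
    move=> t /=; rewrite in_itv/= andbT lee_fin => t0.
    rewrite /exponential_pdf patchE mem_set/=; last by rewrite in_itv/= ltW.
    rewrite /C -(mulrA _ 2) mulVKf//.
    rewrite (_ : - 2^-1 * t = t / 2 + - t); last by lra.
    rewrite expRD mulrA ler_wpM2r ?expR_ge0//.
    by apply: powR_le_expR; [rewrite subr_ge0 p1 pn|exact: ltW].
  apply: ge0_subset_integral => //.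
  - apply/measurable_EFinP; apply: measurable_funM => //.
    exact: measurable_exponential_pdf.
  - by move=> t _; rewrite lee_fin mulr_ge0// exponential_pdf_ge0.
under eq_integral do rewrite EFinM.
rewrite ge0_integralZl//.
- by rewrite integral_exponential_pdf// mule1 ltry.
- by apply/measurable_EFinP; exact: measurable_exponential_pdf.
- by move=> t _; rewrite lee_fin exponential_pdf_ge0.
Qed.

Lemma kappa_gt0 (k : nat) : 0 < kappa R k.
Proof.
rewrite divr_gt0 ?powR_gt0 ?pi_gt0// Gamma_gt0//.
by rewrite lerDr divr_ge0.
Qed.

End one_dimensional_integrals.

(** * Volume of tubes *)

Section signed_mass.
Context {disp : measure_display} {T : measurableType disp} {R : realType}.
Implicit Types (nu : signed_measure T R) (D S : set T).

Lemma measure_le_integral (mu : {measure set T -> \bar R}) D S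
    (f : T -> \bar R) (c : R) :
  measurable S -> S `<=` D -> 0 <= c -> (forall x, D x -> 0 <= f x)%E ->
  (forall x, S x -> c%:E <= f x)%E ->
  (c%:E * mu S <= \int[mu]_(x in D) f x)%E.
Proof.
move=> mS SD c0 f0 cf; rewrite integral_mkcond ge0_integralTE; last first.
  by move=> x; rewrite patchE; case: ifPn => // /set_mem /f0.
apply: ereal_sup_ubound; exists (scale_nnsfun (indic_nnsfun R mS) c0) => /=.
  move=> x; rewrite patchE /= /mindic indicE; have [xS|xS] := boolP (x \in S).
    rewrite mulr1 ifT; first by apply: cf; exact: set_mem.
    by apply/mem_set/SD/set_mem.
  by rewrite mulr0; case: ifPn => // /set_mem /f0.
by rewrite sintegralrM sintegral_indic.
Qed.

Lemma pos_part_le nu S : (pos_part nu S <= variation_measure nu S)%E.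
Proof. by rewrite [variation_measure _ _]measure_addE leeDl. Qed.

Lemma neg_part_le nu S : (neg_part nu S <= variation_measure nu S)%E.
Proof. by rewrite [variation_measure _ _]measure_addE leeDr. Qed.

Definition signed_mass nu S : R := fine (pos_part nu S) - fine (neg_part nu S).

Lemma signed_mass_le nu S : (variation_measure nu S < +oo)%E ->
  `|signed_mass nu S| <= fine (variation_measure nu S).
Proof.
move=> fS.
have fp : pos_part nu S \is a fin_num.
  by rewrite ge0_fin_numE// (le_lt_trans (pos_part_le nu S)).
have fn : neg_part nu S \is a fin_num.
  by rewrite ge0_fin_numE// (le_lt_trans (neg_part_le nu S)).
rewrite [variation_measure _ _]measure_addE fineD//.
rewrite (le_trans (ler_normB _ _))//.
by rewrite !ger0_norm ?fine_ge0.
Qed.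

Lemma signed_integral_indic nu D S (f : T -> \bar R) (c : R) :
  measurable D -> measurable S -> S `<=` D -> 0 <= c ->
  (variation_measure nu S < +oo)%E ->
  (forall x, D x -> f x = (c * \1_S x)%:E) ->
  signed_integral nu D f = (c * signed_mass nu S)%:E.
Proof.
move=> mD mS SD c0 fS fE; rewrite /signed_integral.
have I (mu : {measure set T -> \bar R}) :
    (\int[mu]_(x in D) f x = c%:E * mu S)%E.
  rewrite (eq_integral (fun x => c%:E * (\1_S x)%:E)%E); last first.
    by move=> x /set_mem /fE.
  rewrite ge0_integralZl//; first by rewrite integral_indic// setIidl.
  by apply/measurable_EFinP; exact: measurable_indic.
have fp : pos_part nu S \is a fin_num.
  by rewrite ge0_fin_numE// (le_lt_trans (pos_part_le nu S)).
have fn : neg_part nu S \is a fin_num.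
  by rewrite ge0_fin_numE// (le_lt_trans (neg_part_le nu S)).
by rewrite !I /signed_mass mulrBr EFinB !EFinM !fineK.
Qed.

End signed_mass.

Section steiner.
Context {R : realType} {d : nat}.
Variables (B : set 'rV[R]_d).
Variable (m : 'I_d -> signed_measure ('rV[R]_d * 'rV[R]_d)%type R).
Hypothesis (B0 : B !=set0) (cB : compact B) (mB : is_support_measures B m).
Implicit Types (G : set ('rV[R]_d * 'rV[R]_d)) (i : 'I_d) (r s t b : R).
Local Notation N := (normal_bundle B).
Local Notation leb := (@lebesgue_measure R).

Lemma reach_ge_normal r : 0 < r -> reach_ge B r `<=` N.
Proof. by move=> r0 p pr; apply/(normal_bundleP B0 cB); exists r. Qed.

Lemma reach_gt_le s t : s <= t -> reach_gt B t `<=` reach_gt B s.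
Proof. by move=> st p; apply: le_lt_trans; rewrite lee_fin. Qed.

Lemma reach_ge_gt s t : 0 <= t -> t < s -> reach_ge B s `<=` reach_gt B t.
Proof.
move=> t0 ts p ps.
have Np : N p by apply: reach_ge_normal ps; exact: le_lt_trans ts.
by apply/(reach_gtP B0 cB Np t0); exists s.
Qed.

Lemma variation_reach_gt_bound i : exists2 I : R, 0 <= I &
  forall t, 0 < t <= 1 ->
  ((t ^+ (d - i))%:E * variation_measure (m i) (N `&` reach_gt B t) <= I%:E)%E.
Proof.
have [_ /(_ i B 1 cB ltr01) fI _] := mB.
set J := integral _ _ _ in fI.
have f0 p : N p ->
    (0 <= (\1_B p.1)%:E * mine 1%:E (local_reach B p) ^+ (d - i))%E.
  move=> Np; rewrite mule_ge0// ?lee_fin// expe_ge0//.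
  rewrite le_min lee_fin ler01/= ltW//.
  apply/(reach_gtP B0 cB Np (lexx 0)); exact/(normal_bundleP B0 cB).
have J0 : (0 <= J)%E by apply: integral_ge0 => p; exact: f0.
exists (fine J); first exact: fine_ge0.
move=> t /andP[t0 t1]; rewrite fineK ?ge0_fin_numE//.
apply: measure_le_integral => //.
- by apply: measurable_reach_gt => //; exact: ltW.
- by rewrite exprn_ge0// ltW.
move=> p [/(normal_bundleP B0 cB)[s s0 [Bp _ _]] pt].
rewrite indicE mem_set// mul1e EFin_expe.
have : (t%:E <= mine 1%:E (local_reach B p))%E.
  by rewrite le_min lee_fin t1/= ltW.
move=> tm; elim: (d - i)%N => // n IH; rewrite !expeS; apply: lee_pmul => //.
  by rewrite lee_fin ltW.
by rewrite expe_ge0// lee_fin ltW.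
Qed.

Lemma variation_reach_gt i t : 0 < t ->
  (variation_measure (m i) (N `&` reach_gt B t) < +oo)%E.
Proof.
move=> t0; have [I I0 HI] := variation_reach_gt_bound i.
pose s := Num.min t 1.
have s0 : 0 < s by rewrite lt_min t0 ltr01.
have s1 : s <= 1 by rewrite ge_min lexx orbT.
have /HI : 0 < s <= 1 by rewrite s0.
rewrite -lee_pdivlMl ?exprn_gt0// => h.
apply: (@le_lt_trans _ _ (variation_measure (m i) (N `&` reach_gt B s))).
  apply: le_measure; rewrite ?inE.
  - by apply: measurable_reach_gt => //; exact: ltW.
  - by apply: measurable_reach_gt => //; exact: ltW.
  - by apply: setIS; apply: reach_gt_le; rewrite ge_min lexx.
by rewrite (le_lt_trans h)// -EFinM ltry.
Qed.

Lemma variation_reach_ge i r G : 0 < r -> measurable G ->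
  (variation_measure (m i) (G `&` reach_ge B r) < +oo)%E.
Proof.
move=> r0 mG; have r20 : 0 < r / 2 by rewrite divr_gt0.
apply: le_lt_trans (variation_reach_gt i r20).
apply: le_measure; rewrite ?inE.
- by apply: measurableI => //; exact: measurable_reach_ge.
- by apply: measurable_reach_gt => //; exact: ltW.
- move=> p [_ pr]; split; first exact: reach_ge_normal pr.
  by apply: reach_ge_gt pr; [exact: ltW|rewrite gtr_pMr// invf_lt1// ltr1n].
Qed.

Lemma steiner_set (E : set 'rV[R]_d) (C : set 'rV[R]_d) :
  measurable E -> compact C -> E `<=` C `\` B ->
  (lebesgue_rV R d E = \sum_(i < d) ((omega R (d - i))%:E *
     \int[@lebesgue_measure R]_(t in `]0%R, +oo[)
        signed_integral (m i) N (fun p =>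
          (t ^+ (d - i - 1) * \1_(reach_gt B t) p
            * \1_E (p.1 + t *: p.2))%:E)))%E.
Proof.
move=> mE cC EC; have [_ _ <-] := mB; last 3 first.
- exact: measurable_indic.
- by exists 1 => x; rewrite indicE; case: (_ \in _); rewrite ?normr1// normr0.
- apply: (subclosed_compact _ cC); first exact: closed_closure.
  have clC : closed C by apply: compact_closed => //; exact: norm_hausdorff.
  rewrite [X in _ `<=` X]((closure_id C).1 clC); apply: closure_subset => x /=.
  rewrite indicE; case: (boolP (x \in E)) => [/set_mem/EC[]//|].
  by rewrite eqxx.
rewrite integral_indic//; last first.
  by apply: measurableC; exact: compact_measurable_rV.
by rewrite setIidl// => x /EC[].
Qed.

Lemma tube_volume r G b : 0 < b -> b < r -> measurable G ->
  lebesgue_rV R d (tube B r G b) =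
  (\sum_(i < d) kappa R (d - i) * b ^+ (d - i) *
     signed_mass (m i) (G `&` reach_ge B r))%:E.
Proof.
move=> b0 br mG; have r0 : 0 < r by exact: lt_trans br.
rewrite (@steiner_set _ (parallel_set B b)); last 3 first.
- exact: measurable_tube.
- exact: compact_parallel_set.
- move=> z /(dist_tube B0 cB br) /andP[z0 zb]; split => //.
  by move=> /(dist_to_eq0 B0 cB) z00; rewrite z00 ltxx in z0.
rewrite -sumEFin; apply: eq_bigr => i _.
have di : (0 < d - i)%N by rewrite subn_gt0.
set M := signed_mass _ _.
have powE (t : R) : 0 < t -> t ^+ (d - i - 1) = t `^ ((d - i)%:R - 1).
  by move=> t0; rewrite -powR_mulrn ?(ltW t0)// natrB.
pose f (t : R) : \bar R := (if t <= b then M * t `^ ((d - i)%:R - 1) else 0)%:E.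
transitivity ((omega R (d - i))%:E * \int[leb]_(t in `]0%R, +oo[) f t)%E.
  congr (_ * _)%E; apply: eq_integral => t; rewrite inE/= in_itv/= andbT => t0.
  rewrite (@signed_integral_indic _ _ _ _ _ (G `&` reach_ge B r) _
    (t ^+ (d - i - 1) * (t <= b)%R%:R)).
  - rewrite /f -/M powE//.
    by case: ifP => _; rewrite ?mulr1 ?mulr0 ?mul0r// mulrC.
  - exact: measurable_normal_bundle.
  - by apply: measurableI => //; exact: measurable_reach_ge.
  - by move=> p [_]; exact: reach_ge_normal.
  - by rewrite mulr_ge0// exprn_ge0// ltW.
  - exact: variation_reach_ge.
  move=> p Np; congr (_%:E); rewrite -!mulrA; congr (_ * _).
  rewrite !indicE -natrM mulnb -natrM mulnb; congr ((nat_of_bool _)%:R).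
  apply/andP/andP => [[/set_mem pt /set_mem]|].
    move=> /(tube_normal B0 cB G t0 br Np pt).
    by move=> [pr Gp tb]; split => //; apply: mem_set.
  move=> [tb /set_mem [Gp pr]].
  have pt : reach_gt B t p.
    by apply: (reach_ge_gt (ltW t0) _ pr); exact: le_lt_trans br.
  by split; apply: mem_set => //; apply/(tube_normal B0 cB G t0 br Np pt).
rewrite (integral_truncate (b := b)); last first.
  by move=> t bt; rewrite /f leNgt bt.
transitivity ((omega R (d - i))%:E *
    \int[leb]_(t in `]0%R, b]) (M%:E * (t `^ ((d - i)%:R - 1))%:E))%E.
  congr (_ * _)%E; apply: eq_integral => t.
  by rewrite inE/= in_itv/= => /andP[_ tb]; rewrite /f tb.
have di0 : 0 < (d - i)%:R :> R by rewrite ltr0n.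
rewrite integralZl//; last exact: integrable_powR.
rewrite integral_powR// -!EFinM powR_mulrn ?(ltW b0)//; congr (_%:E).
rewrite /omega; set k : R := (d - i)%:R in di0 *.
have k0 : k != 0 by rewrite gt_eqF.
by field.
Qed.

End steiner.

(** * Support measures of parallel sets *)

Section polynomials.
Context {R : realType}.

Lemma poly_eq0_on_itv (p : {poly R}) (r : R) : 0 < r ->
  (forall b, 0 < b < r -> p.[b] = 0) -> p = 0.
Proof.
move=> r0 pr; apply: contrapT => /eqP p0.
pose rs := [seq r / n.+2%:R | n <- iota 0 (size p)].
have := @max_poly_roots _ p rs p0; rewrite size_map size_iota ltnn.
have -> : all (root p) rs.
  apply/allP => _ /mapP[n _ ->]; apply/eqP/pr.
  by rewrite divr_gt0//= gtr_pMr// invf_lt1// ltr1n.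
have -> : uniq rs.
  rewrite map_inj_uniq ?iota_uniq// => x y.
  move=> /(mulfI (lt0r_neq0 r0))/invr_inj/eqP.
  by rewrite eqr_nat => /eqP[].
by move=> /(_ isT isT).
Qed.

Lemma coef_unique_on_itv (d : nat) (a c : 'I_d -> R) (r : R) : 0 < r ->
  (forall b, 0 < b < r ->
    \sum_(i < d) a i * b ^+ (d - i) = \sum_(i < d) c i * b ^+ (d - i)) ->
  a =1 c.
Proof.
move=> r0 ac i; pose p := \sum_(i < d) (a i - c i) *: 'X^(d - i) : {poly R}.
have p0 : p = 0.
  apply: (poly_eq0_on_itv r0) => b /ac/eqP; rewrite -subr_eq0 => /eqP <-.
  rewrite horner_sum -sumrB; apply: eq_bigr => j _.
  by rewrite !hornerE mulrBl.
have : p`_(d - i) = 0 by rewrite p0 coef0.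
rewrite coef_sum (bigD1 i)//= coefZ coefXn eqxx mulr1 big1 ?addr0 => [|j ji].
  by move=> /eqP; rewrite subr_eq0 => /eqP.
rewrite coefZ coefXn; case: eqP => [/eqP|_]; last by rewrite mulr0.
move=> h; exfalso; move/negP: ji; apply; apply/eqP/val_inj => /=.
have := ltn_ord i; have := ltn_ord j; move/eqP : h; lia.
Qed.

Lemma exprD_sub (d : nat) (j : 'I_d) (b e : R) :
  (b + e) ^+ (d - j) - e ^+ (d - j) =
  \sum_(i < d | (j <= i)%N) 'C(d - j, d - i)%:R * e ^+ (i - j) * b ^+ (d - i).
Proof.
rewrite exprDn big_ord_recr/= subnn expr0 mul1r binn mulr1n addrK.
rewrite -(big_mkord xpredT (fun k =>
  b ^+ (d - j - k) * e ^+ k *+ 'C(d - j, k))).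
pose F i := 'C(d - j, d - i)%:R * e ^+ (i - j) * b ^+ (d - i).
rewrite -(big_geq_mkord _ _ xpredT F).
have := big_addn 0 d j xpredT F; rewrite add0n => ->.
apply: eq_big_nat => k /andP[_ kd]; rewrite /F addnK addnC subnDA -mulr_natl.
by rewrite bin_sub; [ring|lia].
Qed.

End polynomials.

Section parallel_mass.
Context {R : realType} {d : nat}.
Local Notation Rd := 'rV[R]_d.

Lemma signed_mass_cvg {disp} {T : measurableType disp} (nu : signed_measure T R)
    (F : (set T)^nat) : nondecreasing_seq F -> (forall n, measurable (F n)) ->
  (variation_measure nu (\bigcup_n F n) < +oo)%E ->
  signed_mass nu (F n) @[n --> \oo] --> signed_mass nu (\bigcup_n F n).
Proof.
move=> ndF mF fF; have mU := bigcupT_measurable F mF.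
have fp : pos_part nu (\bigcup_n F n) \is a fin_num.
  by rewrite ge0_fin_numE// (le_lt_trans (pos_part_le nu _)).
have fn : neg_part nu (\bigcup_n F n) \is a fin_num.
  by rewrite ge0_fin_numE// (le_lt_trans (neg_part_le nu _)).
apply: cvgB; apply: fine_cvg; rewrite fineK//.
- exact: (nondecreasing_cvg_mu mF mU ndF).
- exact: (nondecreasing_cvg_mu mF mU ndF).
Qed.

Lemma basic_functionE (A : set Rd) (m : 'I_d -> signed_measure (Rd * Rd)%type R)
    (j : 'I_d) (t : R) : A !=set0 -> compact A -> is_support_measures A m ->
  0 < t ->
  basic_function A m j t =
    (signed_mass (m j) (normal_bundle A `&` reach_gt A t))%:E.
Proof.
move=> A0 cA mA t0; rewrite -[signed_mass _ _]mul1r.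
apply: signed_integral_indic => //.
- exact: measurable_normal_bundle.
- by apply: measurable_reach_gt => //; exact: ltW.
- exact: variation_reach_gt.
- by move=> p Np; rewrite mul1r indicI /= [X in X * _]indicE mem_set// mul1r.
Qed.

Variables (A : set Rd) (e : R).
Variables (mA mE : 'I_d -> signed_measure (Rd * Rd)%type R).
Hypothesis (A0 : A !=set0) (cA : compact A) (e0 : 0 < e).
Hypothesis (HA : is_support_measures A mA).
Hypothesis (HE : is_support_measures (parallel_set A e) mE).
Local Notation NA := (normal_bundle A).
Local Notation E := (parallel_set A e).

Let E0 : E !=set0. Proof. exact: parallel_set_neq0 (ltW e0). Qed.
Let cE : compact E. Proof. exact: compact_parallel_set. Qed.

Let shift (p : Rd * Rd) := (p.1 + e *: p.2, p.2).

Let measurable_shift G : measurable G -> measurable (shift @^-1` G).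
Proof.
move=> mG; rewrite -[X in measurable X]setTI.
apply: (measurable_fun_pair _ measurable_snd) => //.
exact: measurable_translate.
Qed.

Lemma parallel_mass r (G : set (Rd * Rd)) (i : 'I_d) : 0 < r -> measurable G ->
  signed_mass (mE i) (G `&` reach_ge E r) =
  \sum_(j < d | (j <= i)%N) steiner_coef R d i j * e ^+ (i - j) *
    signed_mass (mA j) (shift @^-1` G `&` reach_ge A (r + e)).
Proof.
move=> r0 mG; have mG' := measurable_shift mG.
pose a (i : 'I_d) := signed_mass (mE i) (G `&` reach_ge E r).
pose c j := signed_mass (mA j) (shift @^-1` G `&` reach_ge A (r + e)).
have re : e < r + e by rewrite ltrDr.
suff /(coef_unique_on_itv r0)/(_ i) : forall b, 0 < b < r ->
    \sum_(i < d) (kappa R (d - i) * a i) * b ^+ (d - i) =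
    \sum_(i < d) (\sum_(j < d | (j <= i)%N)
      kappa R (d - j) * 'C(d - j, d - i)%:R * e ^+ (i - j) * c j) *
        b ^+ (d - i).
  have k0 k : kappa R k != 0 by rewrite gt_eqF// kappa_gt0.
  move=> /= H; apply: (mulfI (k0 (d - i)%N)); rewrite [LHS]H mulr_sumr.
  apply: eq_bigr => j ji; rewrite /steiner_coef -/(c j).
  by field; exact: k0.
move=> b /andP[b0 br]; have be : b + e < r + e by rewrite ltrD2r.
have be0 : 0 < b + e by rewrite addr_gt0.
have re0 : 0 < r + e by rewrite addr_gt0.
have := tube_parallel A0 cA G e0 r0 br.
move=> /(congr1 (lebesgue_rV R d)); rewrite (tube_volume E0 cE HE)//.
have sub : tube A (r + e) (shift @^-1` G) e `<=`
           tube A (r + e) (shift @^-1` G) (b + e).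
  move=> z [p [t [pr Gp /andP[t0 te] ->]]]; exists p, t; split => //.
  by rewrite t0 (le_trans te)// lerDr ltW.
rewrite -/(shift @^-1` G) measureD; last 3 first.
- exact: measurable_tube.
- exact: measurable_tube.
- by rewrite [ltLHS](tube_volume A0 cA HA)// ltry.
rewrite (setIidr sub) [X in (X - _)%E](tube_volume A0 cA HA be0 be mG').
rewrite [X in (_ - X)%E](tube_volume A0 cA HA e0 re mG') -EFinB => -[].
under eq_bigr do rewrite mulrAC.
move=> ->; rewrite -sumrB.
under eq_bigr => j _
  do rewrite -/(c j) -mulrBl -mulrBr exprD_sub mulr_sumr mulr_suml.
under [RHS]eq_bigr do rewrite mulr_suml.
rewrite (exchange_big_dep xpredT)//=; apply: eq_bigr => k _.
by apply: eq_bigr => j _; ring.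
Qed.

Let reach_geE_cup : normal_bundle E = \bigcup_n reach_ge E n.+1%:R^-1.
Proof. exact: normal_bundleE. Qed.

Let nondecreasing_reach (C : set Rd) (s : R) :
  0 <= s -> C !=set0 -> compact C ->
  nondecreasing_seq (fun n => reach_ge C (s + n.+1%:R^-1)).
Proof.
move=> s0 C0 cC n k nk; rewrite subsetEset; apply: reach_ge_le => //.
  by rewrite addr_ge0// invr_ge0.
by rewrite lerD2l lef_pV2 ?posrE// ler_nat.
Qed.

Lemma parallel_variation_finite i : (variation_measure (mE i) setT < +oo)%E.
Proof.
pose K := \sum_(j < d | (j <= i)%N) steiner_coef R d i j * e ^+ (i - j) *
  fine (variation_measure (mA j) (NA `&` reach_gt A e)).
have c0 j : 0 <= steiner_coef R d i j * e ^+ (i - j).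
  rewrite mulr_ge0 ?exprn_ge0 ?(ltW e0)// mulr_ge0// divr_ge0// ltW//;
  exact: kappa_gt0.
have HK r G : 0 < r -> measurable G ->
    `|signed_mass (mE i) (G `&` reach_ge E r)| <= K.
  move=> r0 mG; rewrite parallel_mass//.
  rewrite (le_trans (ler_norm_sum _ _ _))// ler_sum// => j ji.
  rewrite normrM (ger0_norm (c0 j)) ler_wpM2l//.
  have re0 : 0 < r + e by rewrite addr_gt0.
  have fv := variation_reach_ge A0 cA HA j re0 (measurable_shift mG).
  rewrite (le_trans (signed_mass_le fv))// fine_le ?ge0_fin_numE//.
    exact: variation_reach_gt.
  apply: le_measure; rewrite ?inE.
  - apply: measurableI; first exact: measurable_shift.
    exact: measurable_reach_ge.
  - by apply: measurable_reach_gt => //; exact: ltW.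
  - move=> p [_ pr]; split; first exact: reach_ge_normal pr.
    by apply: reach_ge_gt pr => //; [exact: ltW|rewrite ltrDr].
have mR r : measurable (reach_ge E r) by exact: measurable_reach_ge.
have [H [mH posH negH]] := parts_singular (mE i).
have part (mu : {measure set (Rd * Rd)%type -> \bar R}) (D : set (Rd * Rd)) :
    measurable D -> mu (~` normal_bundle E) = 0%E -> mu (~` D) = 0%E ->
    (forall r : R, 0 < r -> (mu (D `&` reach_ge E r) <= K%:E)%E) ->
    (mu setT < +oo)%E.
  move=> mD muN muD muK; have mN : measurable (normal_bundle E).
    exact: measurable_normal_bundle.
  rewrite -(setUv (normal_bundle E)) measureU//; last 2 first.
  - exact: measurableC.
  - by rewrite setICr.
  rewrite [X in (_ + X)%E]muN adde0 (@le_lt_trans _ _ K%:E) ?ltry//.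
  rewrite reach_geE_cup.
  have nd : nondecreasing_seq (fun n : nat => reach_ge E n.+1%:R^-1).
    by move=> n k /(nondecreasing_reach (lexx 0) E0 cE); rewrite !add0r.
  have h := nondecreasing_cvg_mu (mu := mu) (fun n => mR n.+1%:R^-1)
    (bigcupT_measurable _ (fun n => mR n.+1%:R^-1)) nd.
  rewrite [leLHS](esym (cvg_lim _ h))//; apply: lime_le.
    by apply/cvg_ex; eexists; exact: h.
  apply: nearW => n /=; rewrite (measureDI mu (mR _) mD).
  rewrite [X in (X + _)%E](_ : _ = 0%E); last first.
    apply/eqP; rewrite eq_le measure_ge0 andbT -muD le_measure ?inE//.
    - exact: measurableD.
    - exact: measurableC.
  by rewrite add0e setIC; exact: muK.
have [cN _ _] := HE.
have fv r G : 0 < r -> measurable G ->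
    (variation_measure (mE i) (G `&` reach_ge E r) < +oo)%E.
  exact: variation_reach_ge.
rewrite [variation_measure _ _]measure_addE lte_add_pinfty//.
- apply: (part _ H) => //.
    by apply/eqP; rewrite eq_le measure_ge0 andbT -(cN i) pos_part_le.
  move=> r r0; have fp : pos_part (mE i) (H `&` reach_ge E r) \is a fin_num.
    by rewrite ge0_fin_numE// (le_lt_trans (pos_part_le _ _))// fv.
  rewrite -[leLHS]fineK// lee_fin (le_trans _ (HK r H r0 mH))// /signed_mass.
  rewrite [X in _ - fine X](_ : _ = 0%E) ?subr0 ?ler_norm//.
  apply/eqP; rewrite eq_le measure_ge0 andbT -negH le_measure ?inE//.
  exact: measurableI.
- have mHC : measurable (~` H) by exact: measurableC.
  apply: (part _ (~` H)) => //.
  + by apply/eqP; rewrite eq_le measure_ge0 andbT -(cN i) neg_part_le.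
  + by rewrite setCK.
  move=> r r0; have fn : neg_part (mE i) (~` H `&` reach_ge E r) \is a fin_num.
    by rewrite ge0_fin_numE// (le_lt_trans (neg_part_le _ _))// fv.
  rewrite -[leLHS]fineK// lee_fin (le_trans _ (HK r (~` H) r0 mHC))//.
  rewrite /signed_mass.
  rewrite [X in fine X - _](_ : _ = 0%E) ?sub0r ?normrN ?ler_norm//.
  apply/eqP; rewrite eq_le measure_ge0 andbT -posH le_measure ?inE//.
  exact: measurableI.
Qed.

Lemma total_mass_parallel i : total_mass (mE i) =
  (\sum_(j < d | (j <= i)%N) steiner_coef R d i j * e ^+ (i - j) *
    signed_mass (mA j) (NA `&` reach_gt A e))%:E.
Proof.
have fT := parallel_variation_finite i.
have fp : pos_part (mE i) setT \is a fin_num.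
  by rewrite ge0_fin_numE// (le_lt_trans (pos_part_le _ _)).
have fn : neg_part (mE i) setT \is a fin_num.
  by rewrite ge0_fin_numE// (le_lt_trans (neg_part_le _ _)).
have mN : measurable (normal_bundle E) by exact: measurable_normal_bundle.
have -> : total_mass (mE i) = (signed_mass (mE i) (normal_bundle E))%:E.
  have [cN _ _] := HE.
  have part (mu : {measure set (Rd * Rd)%type -> \bar R}) :
      mu (~` normal_bundle E) = 0%E -> mu setT = mu (normal_bundle E).
    move=> muN; rewrite -(setUv (normal_bundle E)) measureU//.
    - by rewrite [X in (_ + X)%E]muN adde0.
    - exact: measurableC.
    - by rewrite setICr.
  rewrite /total_mass /signed_mass -!part.
  - by rewrite EFinB !fineK.
  - by apply/eqP; rewrite eq_le measure_ge0 andbT -(cN i) neg_part_le.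
  - by apply/eqP; rewrite eq_le measure_ge0 andbT -(cN i) pos_part_le.
congr (_%:E).
have L : signed_mass (mE i) (reach_ge E (0 + n.+1%:R^-1)) @[n --> \oo] -->
    signed_mass (mE i) (normal_bundle E).
  have NE : normal_bundle E = \bigcup_n reach_ge E (0 + n.+1%:R^-1).
    by rewrite reach_geE_cup; apply: eq_bigcupr => n _; rewrite add0r.
  rewrite NE; apply: signed_mass_cvg.
  - exact: nondecreasing_reach.
  - by move=> n; exact: measurable_reach_ge.
  - rewrite -NE (le_lt_trans _ fT)// le_measure ?inE//.
have e0' := ltW e0; have n0 n : 0 < 0 + n.+1%:R^-1 :> R by rewrite add0r.
rewrite -[LHS](cvg_lim _ L)//; apply: cvg_lim => //.
rewrite (_ : (fun n => _) = fun n : nat => \sum_(j < d | (j <= i)%N)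
    steiner_coef R d i j * e ^+ (i - j) *
    signed_mass (mA j) (reach_ge A (e + n.+1%:R^-1))); last first.
  apply/funext => n; rewrite -[reach_ge _ _]setTI parallel_mass//.
  by apply: eq_bigr => j _; rewrite preimage_setT setTI add0r addrC.
apply: cvg_big => [|j ji]; first exact: add_continuous.
apply: cvgM; first exact: cvg_cst.
rewrite reach_gtE//; apply: signed_mass_cvg.
- exact: nondecreasing_reach.
- by move=> n; exact: measurable_reach_ge.
- by rewrite -reach_gtE//; exact: variation_reach_gt.
Qed.

End parallel_mass.

Section weighted_means.
Context {R : realType}.
Local Notation leb := (@lebesgue_measure R).
Implicit Types (f g : R -> R) (p t : R).

Lemma nonincreasing_gt0_measurable f :
  (forall s t, 0 < s -> s <= t -> f t <= f s) ->
  measurable_fun `](0 : R), +oo[ f.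
Proof.
move=> fni.
have -> : (`]0%R, +oo[%classic : set R) =
    \bigcup_n `[(n.+1%:R^-1 : R), +oo[%classic.
  apply/seteqP; split => t /=.
    rewrite in_itv/= andbT => t0; have [n] := ltr_add_invr t0.
    by rewrite add0r => nt; exists n => //=; rewrite in_itv/= andbT ltW.
  by move=> [n _] /=; rewrite !in_itv/= !andbT; apply: lt_le_trans.
apply/measurable_fun_bigcup => // n.
apply: (eq_measurable_fun (fun t => f (Num.max t n.+1%:R^-1))).
  by move=> t; rewrite inE/= in_itv/= andbT => nt; rewrite max_l.
apply: nonincreasing_measurable => // s t st; apply: fni.
  by rewrite lt_max invr_gt0 ltr0n orbT.
by rewrite ge_max !le_max lexx st orbT.
Qed.

Lemma weighted_mean_cvg g (M p : R) :
  0 < p -> measurable_fun `](0 : R), +oo[ g ->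
  g t @[t --> 0^'+] --> M ->
  (\forall e \near 0^'+,
    (\int[leb]_(t in `]0%R, e]) (t `^ (p - 1) * g t)%:E)%E \is a fin_num) /\
  e `^ (- p) * fine (\int[leb]_(t in `]0%R, e]) (t `^ (p - 1) * g t)%:E)%E
    @[e --> 0^'+] --> M / p.
Proof.
move=> p0 mg gM.
have key (h : R) : 0 < h -> \forall e \near 0^'+,
    (\int[leb]_(t in `]0%R, e]) (t `^ (p - 1) * g t)%:E)%E \is a fin_num /\
    `|M / p - e `^ (- p) *
      fine (\int[leb]_(t in `]0%R, e]) (t `^ (p - 1) * g t)%:E)%E| <= h / p.
  move=> h0; move/cvgrPdist_le : gM => /(_ h h0).
  rewrite near_withinE => -[b /= b0 bg].
  have gb t : 0 < t -> t < b -> `|M - g t| <= h.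
    by move=> t0 tb; apply: bg => //=; rewrite sub0r normrN gtr0_norm.
  near=> e.
  have e0 : 0 < e by near: e; exact: nbhs_right_gt.
  have eb : e < b by near: e; exact: nbhs_right_lt.
  have mw (q : R -> R) : measurable_fun `](0 : R), +oo[ q ->
      measurable_fun `]0%R, e] (fun t => (t `^ (p - 1) * q t)%:E).
    move=> mq; apply/measurable_EFinP; apply: measurable_funM.
      exact: measurable_powR_itv.
    apply: measurable_funS mq => //.
    by move=> t /=; rewrite !in_itv/= => /andP[->].
  have iw (q : R -> R) (c : R) : measurable_fun `](0 : R), +oo[ q ->
      (forall t, 0 < t -> t < b -> `|q t| <= c) ->
      leb.-integrable `]0%R, e] (fun t => (t `^ (p - 1) * q t)%:E).
    move=> mq qc.
    have ic : leb.-integrable `]0%R, e] (fun t => c%:E * (t `^ (p - 1))%:E)%E.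
      by apply: integrableZl => //; exact: integrable_powR.
    apply: (@le_integrable _ _ R leb _ _ _ _ (mw _ mq) _ ic) => [|t /=] //.
    rewrite in_itv/= => /andP[t0 te].
    rewrite lee_fin !normrM mulrC ler_wpM2r//.
    rewrite (le_trans (qc _ t0 _)) ?ler_norm//.
    exact: le_lt_trans eb.
  have ig : leb.-integrable `]0%R, e] (fun t => (t `^ (p - 1) * g t)%:E).
    apply: (iw _ (h + `|M|)) => // t t0 tb.
    rewrite -[g t](subrK M) (le_trans (ler_normD _ _))// lerD2r distrC.
    exact: gb.
  have iM : leb.-integrable `]0%R, e] (fun t => (t `^ (p - 1) * M)%:E).
    by apply: (iw (cst M) `|M|).
  have fin :
      (\int[leb]_(t in `]0%R, e]) (t `^ (p - 1) * g t)%:E)%E \is a fin_num.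
    exact: integrable_fin_num.
  split => //.
  set J := fine _.
  have IM : (\int[leb]_(t in `]0%R, e]) (t `^ (p - 1) * M)%:E =
      (M * (e `^ p / p))%:E)%E.
    under eq_integral do rewrite mulrC EFinM.
    by rewrite integralZl ?integral_powR//; exact: integrable_powR.
  have mD : measurable_fun (`](0 : R), e])
      (fun t => (t `^ (p - 1) * M)%:E - (t `^ (p - 1) * g t)%:E)%E.
    by apply: emeasurable_funB; apply: mw.
  have D : `|M * (e `^ p / p) - J| <= h * (e `^ p / p).
    rewrite -lee_fin -[leLHS]/(`|(M * (e `^ p / p) - J)%:E|)%E.
    rewrite EFinB -IM /J fineK//.
    rewrite -integralB//=.
    apply: (le_trans (@le_abse_integral _ _ _ leb _ _ _ mD)) => //.
    apply: (@le_trans _ _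
      (\int[leb]_(t in `]0%R, e]) (h%:E * (t `^ (p - 1))%:E))%E).
      apply: ge0_le_integral => //.
      - by apply: measurableT_comp => //; exact: mD.
      - apply/measurable_EFinP; apply: measurable_funM => //.
        exact: measurable_powR_itv.
      - move=> t /=; rewrite in_itv/= => /andP[t0 te].
        rewrite lee_fin -mulrBr normrM mulrC (ger0_norm (powR_ge0 _ _)).
        by rewrite ler_wpM2r ?powR_ge0// gb// (le_lt_trans te).
    by rewrite integralZl ?integral_powR//; exact: integrable_powR.
  have ep : e `^ (- p) * e `^ p = 1.
    by rewrite -powRD; [rewrite addNr powRr0|rewrite (gt_eqF e0) implybT].
  have -> : M / p = e `^ (- p) * (M * (e `^ p / p)).
    by rewrite mulrCA (mulrA (e `^ _)) ep mul1r.
  rewrite -mulrBr normrM ger0_norm ?powR_ge0//.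
  rewrite (le_trans (ler_wpM2l (powR_ge0 _ _) D))//.
  by rewrite mulrCA (mulrA (e `^ _)) ep mul1r.
split; first by apply: filterS (key 1 ltr01) => e [].
apply/cvgrPdist_le => h h0; have := key (h * p) (mulr_gt0 h0 p0).
by apply: filterS => e [_]; rewrite mulfK// gt_eqF.
Unshelve. all: by end_near. Qed.

End weighted_means.

Section lebesgue_finite.
Context {R : realType}.

Lemma measurable_rV_box (d : nat) (M : R) :
  measurable [set x : 'rV[R]_d | forall j, `|x ord0 j| <= M].
Proof.
have -> : [set x : 'rV[R]_d | forall j, `|x ord0 j| <= M] =
    \bigcap_(j in [set: 'I_d]) ((fun x : 'rV[R]_d => x ord0 j) @^-1` `[- M, M]).
  apply/seteqP; split => x /= h j.
    by move=> _; rewrite /= in_itv/= -ler_norml.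
  by have := h j I; rewrite /= in_itv/= -ler_norml.
apply: fin_bigcap_measurable => [|j _]; first exact: finite_finset.
by rewrite -[X in measurable X]setTI; exact: measurable_coord.
Qed.

Lemma lebesgue_rV_box (d : nat) (M : R) : 0 <= M ->
  (lebesgue_rV R d [set x | forall j, (`|x ord0 j| <= M)%R] < +oo)%E.
Proof.
move=> M0; elim: d => [|d IH].
  by rewrite /= diracE ltry.
rewrite /= /lebesgue_cons /pushforward.
have -> : @consrV R d @^-1` [set x | forall j, `|x ord0 j| <= M] =
    `[- M, M]%classic `*` [set x : 'rV[R]_d | forall j, `|x ord0 j| <= M].
  apply/seteqP; split => -[a x] /=.
    move=> h; split => [|j].
      by have := h ord0; rewrite consrV0 /= in_itv/= ler_norml.
    by have := h (lift ord0 j); rewrite consrVS.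
  move=> [aM xM] j; case: (unliftP ord0 j) => [k|] ->; first by rewrite consrVS.
  by rewrite consrV0 /=; move: aM; rewrite in_itv/= ler_norml.
rewrite product_measure1E//; last first.
  exact: measurable_rV_box.
apply: lte_mul_pinfty => //.
  by rewrite ge0_fin_numE//= lebesgue_measure_itv/=; case: ifP; rewrite ?ltry.
Qed.

Lemma lebesgue_rV_compact (d : nat) (C : set 'rV[R]_d) : compact C ->
  (lebesgue_rV R d C < +oo)%E.
Proof.
move=> cC; have [M [Mr CM]] := compact_bounded cC.
have M1 : M < `|M| + 1 by rewrite (le_lt_trans (ler_norm _))// ltrDl.
have M0 : 0 <= `|M| + 1 by rewrite addr_ge0.
apply: le_lt_trans (lebesgue_rV_box d M0); apply: le_measure; rewrite ?inE.
- exact: compact_measurable_rV.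
- exact: measurable_rV_box.
- move=> x Cx j; apply: le_trans (CM _ M1 _ Cx).
  rewrite [leRHS](mx_normrE x).
  exact: (le_bigmax_cond _ (fun ij : 'I_1 * 'I_d => `|x ij.1 ij.2|)
    (j := (ord0, j))).
Qed.

End lebesgue_finite.

(** * Contents *)

Lemma cvg_real_EFin {R : realType} {T : Type} {F : set_system T} {FF : Filter F}
    (f : T -> R) (a : R) : f x @[x --> F] --> a -> (f x)%:E @[x --> F] --> a%:E.
Proof. by move=> fa; apply: cvg_EFin => //; exact: nearW. Qed.

Section contents.
Context {R : realType} {d : nat} (A : set 'rV[R]_d).
Variable m : 'I_d -> signed_measure ('rV[R]_d * 'rV[R]_d)%type R.
Hypothesis (A0 : A !=set0) (cA : compact A) (mA : is_support_measures A m).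
Implicit Types (i j : 'I_d) (q t e : R).
Local Notation N := (normal_bundle A).
Local Notation leb := (@lebesgue_measure R).

Definition beta j t : R := signed_mass (m j) (N `&` reach_gt A t).

Lemma basic_content_cvg q j (M : R) : has_basic_content A m q j M ->
  t `^ (q - j%:R) * beta j t @[t --> 0^'+] --> M.
Proof.
move=> /fine_cvgP[_]; apply: cvg_trans; apply: near_eq_cvg.
near=> t; have t0 : 0 < t by near: t; exact: nbhs_right_gt.
by rewrite /= (basic_functionE _ A0 cA mA t0).
Unshelve. all: by end_near. Qed.

Lemma measurable_beta j : measurable_fun `](0 : R), +oo[ (beta j).
Proof.
have part (mu : {measure set ('rV[R]_d * 'rV[R]_d)%type -> \bar R}) :
    (forall t, 0 < t -> (mu (N `&` reach_gt A t) < +oo)%E) ->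
    measurable_fun `](0 : R), +oo[ (fun t => fine (mu (N `&` reach_gt A t))).
  move=> fmu; apply: nonincreasing_gt0_measurable => s t s0 st.
  have t0 : 0 < t by exact: lt_le_trans st.
  rewrite fine_le ?ge0_fin_numE ?fmu// le_measure ?inE//.
  - by apply: measurable_reach_gt => //; exact: ltW.
  - by apply: measurable_reach_gt => //; exact: ltW.
  - by apply: setIS; exact: reach_gt_le.
apply: measurable_funB; apply: part => t t0.
- apply: le_lt_trans (pos_part_le _ _) _; exact: variation_reach_gt.
- apply: le_lt_trans (neg_part_le _ _) _; exact: variation_reach_gt.
Qed.

Lemma outer_volume e : 0 < e ->
  lebesgue_rV R d (parallel_set A e `\` A) =
  (\sum_(j < d) (omega R (d - j))%:E *
    \int[leb]_(t in `]0%R, e]) (t ^+ (d - j - 1) * beta j t)%:E)%E.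
Proof.
move=> e0; have cE := @compact_parallel_set _ _ A A0 cA e.
rewrite (@steiner_set _ _ _ _ cA mA _ (parallel_set A e)) => [||//|//];
  last first.
  by apply: measurableD; exact: compact_measurable_rV.
apply: eq_bigr => j _; congr (_ * _)%E.
pose f (t : R) : \bar R :=
  (if t <= e then t ^+ (d - j - 1) * beta j t else 0)%:E.
transitivity (\int[leb]_(t in `]0%R, +oo[) f t)%E.
  apply: eq_integral => t; rewrite inE/= in_itv/= andbT => t0.
  rewrite (@signed_integral_indic _ _ _ _ _ (N `&` reach_gt A t) _
    (t ^+ (d - j - 1) * (t <= e)%R%:R)).
  - by rewrite /f -/(beta j t); case: ifP => _; rewrite ?mulr1 ?mulr0 ?mul0r.
  - exact: measurable_normal_bundle.
  - by apply: measurable_reach_gt => //; exact: ltW.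
  - by move=> p [].
  - by rewrite mulr_ge0// exprn_ge0// ltW.
  - exact: variation_reach_gt.
  case=> x u Np; congr (_%:E); rewrite -!mulrA; congr (_ * _).
  rewrite !indicE -natrM mulnb -natrM mulnb; congr ((nat_of_bool _)%:R).
  have [/set_mem pt|pt] := boolP ((x, u) \in reach_gt A t); last first.
    rewrite /=; apply/esym/negP => /andP[_ /set_mem[_ ]].
    by move=> /mem_set; apply/negP.
  have -> : (x, u) \in N `&` reach_gt A t by apply/mem_set; split.
  rewrite /= andbT.
  have [s ts xs] := (reach_gtP A0 cA Np (ltW t0)).1 pt.
  have dt := dist_reach_ge A0 cA (ltW t0) (ltW ts) xs.
  apply/idP/idP => [/set_mem[]|te]; first by rewrite /parallel_set/= dt.
  apply/mem_set; split; first by rewrite /parallel_set/= dt.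
  by move=> /(dist_to_eq0 A0 cA); rewrite dt => t00; rewrite t00 ltxx in t0.
rewrite (integral_truncate (b := e)); last by move=> t et; rewrite /f leNgt et.
apply: eq_integral => t; rewrite inE/= in_itv/= => /andP[_ te].
by rewrite /f te.
Qed.

Lemma beta_cvg0 q j : d%:R < q ->
  t `^ (q - j%:R) * beta j t @[t --> 0^'+] --> (0 : R).
Proof.
move=> dq; have [I I0 HI] := variation_reach_gt_bound A0 cA mA j.
have qd : 0 < q - d%:R by rewrite subr_gt0.
apply/cvgr0Pnorm_lt => h h0.
have : I * t `^ (q - d%:R) @[t --> 0^'+] --> (0 : R).
  rewrite -[X in _ --> X](mulr0 I).
  by apply: cvgM; [exact: cvg_cst|exact: powR_cvg0].
move=> /cvgr0Pnorm_lt/(_ h h0) Ih; near=> t.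
have t0 : 0 < t by near: t; exact: nbhs_right_gt.
have t1 : t < 1 by near: t; exact: nbhs_right_lt.
have Iht : `|I * t `^ (q - d%:R)| < h by near: t.
apply: le_lt_trans Iht; rewrite normrM (ger0_norm (powR_ge0 _ _)).
rewrite [leRHS]ger0_norm ?mulr_ge0 ?powR_ge0//.
have fv := variation_reach_gt A0 cA mA j t0.
have jd : (j <= d)%N by exact: ltnW.
have -> : q - j%:R = (q - d%:R) + (d - j)%:R by rewrite natrB//; ring.
rewrite powRD; last by rewrite (gt_eqF t0) implybT.
rewrite powR_mulrn ?(ltW t0)// -mulrA [leRHS]mulrC ler_wpM2l ?powR_ge0//.
rewrite (le_trans (ler_wpM2l _ (signed_mass_le fv))) ?exprn_ge0 ?(ltW t0)//.
have : 0 < t <= 1 by rewrite t0 ltW.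
move=> /HI; rewrite -[X in (_ * X <= _)%E]fineK ?ge0_fin_numE//.
Unshelve. all: by end_near. Qed.

Lemma outer_content_lt q (M : 'I_d -> R) : q < d%:R ->
  (forall j, has_basic_content A m q j (M j)) ->
  has_outer_Minkowski_content A q
    ((d%:R - q)^-1 * \sum_(j < d) omega R (d - j) * M j).
Proof.
move=> qd HM; pose p := d%:R - q; have p0 : 0 < p by rewrite subr_gt0.
pose g j t := t `^ (q - j%:R) * beta j t.
have mg j : measurable_fun `](0 : R), +oo[ (g j).
  apply: measurable_funM; first exact: measurable_powR_itv.
  exact: measurable_beta.
have W j := weighted_mean_cvg p0 (mg j) (basic_content_cvg (HM j)).
pose J j e := (\int[leb]_(t in `]0%R, e]) (t `^ (p - 1) * g j t)%:E)%E.
have fin : \forall e \near (0 : R)^'+, forall j, J j e \is a fin_num.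
  by apply: filter_forall => j; exact: (W j).1.
have L : (\sum_(j < d) omega R (d - j) * (e `^ (- p) * fine (J j e)))
    @[e --> 0^'+] --> \sum_(j < d) omega R (d - j) * (M j / p).
  apply: cvg_big => [|j _]; first exact: add_continuous.
  by apply: cvgM; [exact: cvg_cst|exact: (W j).2].
have -> : (d%:R - q)^-1 * \sum_(j < d) omega R (d - j) * M j =
    \sum_(j < d) omega R (d - j) * (M j / p).
  by rewrite mulr_sumr; apply: eq_bigr => j _; rewrite -/p; ring.
apply: cvg_trans (cvg_real_EFin L); apply: near_eq_cvg; near=> e.
have e0 : 0 < e by near: e; exact: nbhs_right_gt.
have fe : forall j, J j e \is a fin_num by near: e.
have -> : q - d%:R = - p by rewrite opprB.
rewrite outer_volume// (eq_bigr (fun j => (omega R (d - j) * fine (J j e))%:E)).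
  rewrite sumEFin -EFinM; congr (_%:E); rewrite mulr_sumr.
  by apply: eq_bigr => j _; rewrite mulrCA.
move=> j _; rewrite [RHS]EFinM fineK//; congr (_ * _)%E.
apply: eq_integral => t; rewrite inE/= in_itv/= => /andP[t0 _]; congr (_%:E).
rewrite /g mulrA -powRD; last by rewrite (gt_eqF t0) implybT.
rewrite -powR_mulrn ?(ltW t0)// !natrB ?subn_gt0// ?(ltnW (ltn_ord j))//.
by congr (_ `^ _ * _); rewrite /p; ring.
Unshelve. all: by end_near. Qed.

Lemma outer_content_gt q (M : 'I_d -> R) : d%:R < q ->
  (forall j, has_basic_content A m q j (M j)) ->
  has_outer_Minkowski_content A q
    ((d%:R - q)^-1 * \sum_(j < d) omega R (d - j) * M j).
Proof.
move=> dq HM; have qd : 0 < q - d%:R by rewrite subr_gt0.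
rewrite big1 ?mulr0 => [|j _]; last first.
  have := cvg_unique _ (basic_content_cvg (HM j)) (beta_cvg0 j dq).
  by move=> ->; rewrite ?mulr0.
have c1 := @compact_parallel_set _ _ A A0 cA 1.
have mD e : measurable (parallel_set A e `\` A).
  apply: measurableD; apply: compact_measurable_rV => //.
  exact: compact_parallel_set.
pose K := fine (lebesgue_rV R d (parallel_set A 1)).
have K1 : (lebesgue_rV R d (parallel_set A 1) <= K%:E)%E.
  by rewrite fineK// ge0_fin_numE// lebesgue_rV_compact.
apply: (@squeeze_cvge _ _ _ _ (cst 0%E) _ (fun e => (e `^ (q - d%:R) * K)%:E)).
- near=> e; have e0 : 0 < e by near: e; exact: nbhs_right_gt.
  have e1 : e < 1 by near: e; exact: nbhs_right_lt.
  rewrite /= mule_ge0 ?lee_fin ?powR_ge0//=.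
  rewrite EFinM lee_wpmul2l ?lee_fin ?powR_ge0//.
  apply: le_trans K1; apply: le_measure; rewrite ?inE//.
    exact: compact_measurable_rV.
  by move=> x [xe _]; rewrite /parallel_set/= (le_trans xe)// ltW.
- exact: cvg_cst.
- apply: cvg_EFin; first exact: nearW.
  rewrite -[X in _ --> X](mul0r K).
  by apply: cvgM; [exact: powR_cvg0|exact: cvg_cst].
Unshelve. all: by end_near. Qed.

End contents.

Theorem theorem6p9 (R : realType) (d : nat) (hd : (2 <= d)%N)
    (mu : set 'rV[R]_d -> 'I_d -> signed_measure ('rV[R]_d * 'rV[R]_d)%type R)
    (hmu : forall B : set 'rV[R]_d, closed B -> B !=set0 ->
      is_support_measures B (mu B))
    (A : set 'rV[R]_d) (hA0 : A !=set0) (hAc : compact A)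
    (i : 'I_d) (q : R) :
  (forall M : 'I_d -> R,
    (forall j : 'I_d, (j <= i)%N -> has_basic_content A (mu A) q j (M j)) ->
    has_support_content A mu q i
      (\sum_(j < d | (j <= i)%N) steiner_coef R d i j * M j)) /\
  (q != d%:R ->
    forall M : 'I_d -> R,
    (forall j : 'I_d, has_basic_content A (mu A) q j (M j)) ->
    has_outer_Minkowski_content A q
      ((d%:R - q)^-1 * \sum_(j < d) omega R (d - j) * M j)).
Proof.
have mA : is_support_measures A (mu A).
  by apply: hmu => //; apply: compact_closed => //; exact: norm_hausdorff.
split=> [M HM|]; last first.
  rewrite neq_lt => /orP[qd|dq] M HM; first exact: outer_content_lt HM.
  exact: outer_content_gt HM.
have L : (\sum_(j < d | (j <= i)%N) steiner_coef R d i j *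
    (e `^ (q - j%:R) * beta A (mu A) j e)) @[e --> 0^'+] -->
    \sum_(j < d | (j <= i)%N) steiner_coef R d i j * M j.
  apply: cvg_big => [|j ji]; first exact: add_continuous.
  apply: cvgM; first exact: cvg_cst.
  exact: basic_content_cvg (HM j ji).
apply: cvg_trans (cvg_real_EFin L); apply: near_eq_cvg; near=> e.
have e0 : 0 < e by near: e; exact: nbhs_right_gt.
have mE : is_support_measures (parallel_set A e) (mu (parallel_set A e)).
  apply: hmu; first exact: closed_parallel_set.
  exact: parallel_set_neq0 (ltW e0).
rewrite (total_mass_parallel hA0 hAc e0 mA mE) -EFinM; congr (_%:E).
rewrite mulr_sumr; apply: eq_bigr => j ji; rewrite -/(beta A (mu A) j e).
have -> : q - j%:R = (q - i%:R) + (i - j)%:R by rewrite natrB//; ring.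
rewrite powRD; last by rewrite (gt_eqF e0) implybT.
by rewrite powR_mulrn ?(ltW e0)//; ring.
Unshelve. all: by end_near. Qed.
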